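(* Let $f(x)\in\mathbb{Z}[x]$ be a Cappell-Shaneson polynomial of degree $n$, let $f^*(x)=(-x)^nf(x^{-1})$, and let $\theta$ be a root of $f$. Put $X_f=\{A\in\operatorname{M}(n;\mathbb{Z})\mid f(A)=O\}\cup\{A\in\operatorname{M}(n;\mathbb{Z})\mid f^*(A)=O\}$. Then there is a one-to-one correspondence between the ideal class monoid $C(\mathbb{Z}[\theta])$ and $X_f/\sim_*$. More precisely, the following two maps are well defined, bijective, and inverse to each other, $\overline{\phi_f}^{-1}=\overline{\psi_f}$: (1) $\overline{\phi_f}: X_f/\sim_*\ \to C(\mathbb{Z}[\theta])$. Given a class in $X_f/\sim_*$, choose a representative $A$ with $f(A)=O$ and an eigenvector $v=[v_1,\ldots,v_n]^{\mathrm T}\in\mathbb{Z}[\theta]^n$ of $A$ corresponding to the eigenvalue $\theta$, and set $\overline{\phi_f}([A])=[S]$, where $S$ is the $\mathbb{Z}$-submodule of $\mathbb{Z}[\theta]$ generated by $v_1,\ldots,v_n$ (which is an ideal). (2) $\overline{\psi_f}: C(\mathbb{Z}[\theta])\to X_f/\sim_*$. Given a non-zero ideal $S$ of $\mathbb{Z}[\theta]$ with $\mathbb{Z}$-basis $\{v_1,\ldots,v_n\}$, let $v=[v_1,\ldots,v_n]^{\mathrm T}$, let $A\in\operatorname{M}(n;\mathbb{Z})$ be the matrix such that $\theta v=Av$, and set $\overline{\psi_f}([S])=[A]$.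
   Context: A matrix $A\in\operatorname{SL}(n;\mathbb{Z})$ is a Cappell-Shaneson matrix if for every integer $k\in\{1,\ldots,\lfloor n/2\rfloor\}$ one has $\det(I-\bigwedge^k A)=\pm1$, where $\bigwedge^k A$ is the $k$-th exterior power of $A$. A monic polynomial of degree $n$ is a Cappell-Shaneson polynomial if it is the characteristic polynomial of some Cappell-Shaneson matrix in $\operatorname{SL}(n;\mathbb{Z})$. (It is known that Cappell-Shaneson polynomials are irreducible over $\mathbb{Z}$.) For $A,B\in\operatorname{GL}(n;\mathbb{Z})$, $A\sim_* B$ ($*$-equivalence) means that $A$ is conjugate in $\operatorname{GL}(n;\mathbb{Z})$ to $B$ or to $B^{-1}$. For an integral domain $R$, the ideal class monoid $C(R)$ is the set of non-zero ideals of $R$ modulo the relation $I\approx J$ if and only if there exist non-zero $\alpha,\beta\in R$ with $\alpha I=\beta J$, with the operation induced by multiplication of ideals; $[I]$ denotes the class of $I$. *)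

(* Defs.v *)
From HB Require Import structures.
From mathcomp Require Import all_boot all_order all_algebra.
From mathcomp Require Import boolp classical_sets.

Set Implicit Arguments.
Unset Strict Implicit.
Unset Printing Implicit Defensive.

Import Order.TTheory GRing.Theory Num.Theory.
Local Open Scope ring_scope.
Local Open Scope quotient_scope.

(* The increasing k-tuples t index the basis e_{t_0} /\ ... /\ e_{t_(k-1)} of
   the k-th exterior power; in this basis the matrix of the k-th exterior power
   of A has the k x k minors of A as entries. *)
Definition wedge_basis (n k : nat) : {set k.-tuple 'I_n} :=
  [set t : k.-tuple 'I_n | sorted ltn [seq val i | i <- t]]%SET.

Definition exterior_power (R : comNzRingType) (n k : nat) (A : 'M[R]_n) :
    'M[R]_#|wedge_basis n k| :=
  \matrix_(i, j) \det (mxsub (tnth (enum_val i)) (tnth (enum_val j)) A).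

Definition cappell_shaneson_mx (n : nat) (A : 'M[int]_n) : Prop :=
  \det A = 1 /\
  forall k : nat, (1 <= k <= n./2)%N ->
    \det (1%:M - exterior_power k A) = 1 \/
    \det (1%:M - exterior_power k A) = -1.

Definition cappell_shaneson_poly (n : nat) (f : {poly int}) : Prop :=
  exists2 A : 'M[int]_n, cappell_shaneson_mx A & f = char_poly A.

(* (-x)^n f(x^-1), written as a polynomial for f of degree at most n. *)
Definition starpoly (n : nat) (f : {poly int}) : {poly int} :=
  \sum_(i < n.+1) ((-1) ^+ n * f`_i) *: 'X^(n - i).

Lemma starpolyE (F : fieldType) (n : nat) (f : {poly int}) (x : F) :
  (size f <= n.+1)%N -> x != 0 ->
  (map_poly intr (starpoly n f)).[x] =
  (- x) ^+ n * (map_poly intr f).[x^-1].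
Proof.
move=> sf x0; rewrite raddf_sum horner_sum /=.
rewrite (@horner_coef_wide _ n.+1) ?(leq_trans (size_poly _ _)) //.
rewrite mulr_sumr; apply: eq_bigr => i _.
rewrite map_polyZ /= map_polyXn hornerZ hornerXn coef_map /= rmorphM rmorphXn.
rewrite rmorphN1 (exprNn x) -!mulrA; congr (_ * _); rewrite [RHS]mulrCA.
have le_in : (i <= n)%N by rewrite -ltnS.
congr (_ * _); rewrite exprVn -[X in _ = x ^+ X / _](subnK le_in) exprD.
by rewrite mulfK // expf_neq0.
Qed.

(* A is conjugate in GL(n; Z) to B or to B^-1; only meant for A and B
   invertible. *)
Definition star_equiv (n : nat) (A B : 'M[int]_n) : Prop :=
  exists2 P : 'M[int]_n, P \in unitmx &
    A = P *m B *m invmx P \/ A = P *m invmx B *m invmx P.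

Section StarEquiv.
Variable n : nat.
Implicit Types A B P : 'M[int]_n.

Lemma invmx_conj P B : P \in unitmx ->
  invmx (P *m B *m invmx P) = P *m invmx B *m invmx P.
Proof.
move=> uP; have [uB|nuB] := boolP (B \in unitmx); last first.
  have nuPB : P *m B *m invmx P \notin unitmx.
    by rewrite !unitmx_mul unitmx_inv uP andbT.
  by rewrite (invmx_out nuPB) (invmx_out nuB).
have uB' : P *m B *m invmx P \in unitmx.
  by rewrite !unitmx_mul uP uB unitmx_inv.
apply: (can_inj (mulKmx uB')); rewrite mulmxV // !mulmxA.
by rewrite mulmxKV // mulmxK // mulmxV.
Qed.

Lemma star_equiv_refl A : star_equiv A A.
Proof. by exists 1%:M; rewrite ?unitmx1 // invmx1 mul1mx mulmx1; left. Qed.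

Lemma star_equiv_sym A B : star_equiv A B -> star_equiv B A.
Proof.
have conjK P B' : P \in unitmx ->
    B' = invmx P *m (P *m B' *m invmx P) *m invmx (invmx P).
  by move=> uP; rewrite invmxK -!mulmxA mulKmx // mulVmx // mulmx1.
case=> P uP [->|->]; (exists (invmx P); first by rewrite unitmx_inv).
  by left; apply: conjK.
by right; rewrite invmx_conj // invmxK; apply: conjK.
Qed.

Lemma star_equiv_trans A B D :
  star_equiv A B -> star_equiv B D -> star_equiv A D.
Proof.
case=> P uP AB [Q uQ BD]; exists (P *m Q); first by rewrite unitmx_mul uP.
have PQ X : P *m (Q *m X *m invmx Q) *m invmx P =
    (P *m Q) *m X *m invmx (P *m Q).
  rewrite -!mulmxA; congr (_ *m (_ *m (_ *m _))).
  have uPQ : P *m Q \in unitmx by rewrite unitmx_mul uP.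
  apply: (can_inj (mulKmx uPQ)); rewrite mulmxV // mulmxA.
  by rewrite mulmxK // mulmxV.
by case: AB BD => -> [->|->]; rewrite ?invmx_conj ?invmxK // PQ;
  [left|right|right|left].
Qed.

End StarEquiv.

(* Matrices have size n.+1, so that horner_mx is available. *)
Definition in_X (n : nat) (f : {poly int}) (A : 'M[int]_n.+1) : bool :=
  (horner_mx A f == 0) || (horner_mx A (starpoly n.+1 f) == 0).

Definition X_set (n : nat) (f : {poly int}) : Type :=
  {A : 'M[int]_n.+1 | in_X f A}.
HB.instance Definition _ n f := Choice.on (@X_set n f).
HB.instance Definition _ n f := SubType.on (@X_set n f).

Section StarClasses.
Variables (n : nat) (f : {poly int}).

Definition X_star_rel (A B : X_set n f) : bool :=
  `[< star_equiv (\val A) (\val B) >].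

Lemma X_star_rel_refl : reflexive X_star_rel.
Proof. by move=> A; apply/asboolP/star_equiv_refl. Qed.

Lemma X_star_rel_sym : symmetric X_star_rel.
Proof. by move=> A B; apply/asboolP/asboolP; apply: star_equiv_sym. Qed.

Lemma X_star_rel_trans : transitive X_star_rel.
Proof.
by move=> B A D /asboolP AB /asboolP BD; apply/asboolP/(star_equiv_trans AB).
Qed.

Canonical X_star_equiv :=
  EquivRel X_star_rel X_star_rel_refl X_star_rel_sym X_star_rel_trans.

Definition X_star : Type := {eq_quot X_star_equiv}.
HB.instance Definition _ := Choice.on X_star.
HB.instance Definition _ := EqQuotient.on X_star.

Definition star_class (A : X_set n f) : X_star := \pi_X_star A.

End StarClasses.

Section IdealClasses.
Variable R : idomainType.
Local Open Scope classical_set_scope.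

Record is_nonzero_ideal (S : set R) : Prop := IsNonzeroIdeal {
  ideal0 : S 0;
  idealD : forall x y, S x -> S y -> S (x + y);
  idealM : forall a x, S x -> S (a * x);
  ideal_neq0 : exists2 x, S x & x != 0 }.

Record nonzero_ideal : Type := NonzeroIdeal {
  ideal_set :> set R;
  nonzero_idealP : is_nonzero_ideal ideal_set }.
HB.instance Definition _ := gen_eqMixin nonzero_ideal.
HB.instance Definition _ := gen_choiceMixin nonzero_ideal.

Definition ideal_equiv (I J : nonzero_ideal) : Prop :=
  exists a b : R, [/\ a != 0, b != 0 &
    [set a * x | x in (I : set R)] = [set b * x | x in (J : set R)]].

Definition ideal_rel (I J : nonzero_ideal) : bool := `[< ideal_equiv I J >].

Lemma ideal_rel_refl : reflexive ideal_rel.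
Proof. by move=> I; apply/asboolP; exists 1, 1; split; rewrite ?oner_eq0. Qed.

Lemma ideal_rel_sym : symmetric ideal_rel.
Proof.
by move=> I J; apply/asboolP/asboolP => -[a [b [a0 b0 E]]]; exists b, a; split.
Qed.

Lemma ideal_rel_trans : transitive ideal_rel.
Proof.
move=> J I K /asboolP[a [b [a0 b0 IJ]]] /asboolP[c [d [c0 d0 JK]]].
apply/asboolP; exists (c * a), (b * d); split; rewrite ?mulf_neq0 //.
have im (x y : R) (S : set R) : [set x * y * z | z in S] =
    [set x * z | z in [set y * z | z in S]].
  rewrite image_comp; congr (image _ _); apply/funext => z /=.
  by rewrite mulrA.
by rewrite im IJ -im (mulrC c b) (im b c) JK -im.
Qed.

Canonical ideal_equiv_rel :=
  EquivRel ideal_rel ideal_rel_refl ideal_rel_sym ideal_rel_trans.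

Definition ideal_class_monoid : Type := {eq_quot ideal_equiv_rel}.
HB.instance Definition _ := Choice.on ideal_class_monoid.
HB.instance Definition _ := EqQuotient.on ideal_class_monoid.

Definition ideal_class (I : nonzero_ideal) : ideal_class_monoid :=
  \pi_ideal_class_monoid I.

Definition Zspan (m : nat) (v : 'cV[R]_m) : set R :=
  [set x | exists c : 'I_m -> int, x = \sum_i v i 0 *~ c i].

Definition is_Zbasis (S : set R) (m : nat) (v : 'cV[R]_m) : Prop :=
  S = Zspan v /\
  forall c : 'I_m -> int, \sum_i v i 0 *~ c i = 0 -> forall i, c i = 0.

End IdealClasses.

(* The subring Z[theta] of C, as an integral domain. *)
Section Zadjoin.
Variables (C : numClosedFieldType) (theta : C).

Definition in_Zadjoin : {pred C} :=
  fun x => `[< exists p : {poly int}, x = (map_poly intr p).[theta] >].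

Lemma in_Zadjoin_subring : subring_closed in_Zadjoin.
Proof.
split.
- by apply/asboolP; exists 1; rewrite rmorph1 hornerC.
- move=> _ _ /asboolP[p ->] /asboolP[q ->]; apply/asboolP; exists (p - q).
  by rewrite rmorphB hornerD hornerN.
- move=> _ _ /asboolP[p ->] /asboolP[q ->]; apply/asboolP; exists (p * q).
  by rewrite rmorphM hornerM.
Qed.

HB.instance Definition _ :=
  GRing.isSubringClosed.Build C in_Zadjoin in_Zadjoin_subring.

Record Zadjoin : Type := InZadjoin {
  Zadjoin_val : C;
  Zadjoin_valP : Zadjoin_val \in in_Zadjoin }.

HB.instance Definition _ := [isSub for Zadjoin_val].
HB.instance Definition _ := [Choice of Zadjoin by <:].
HB.instance Definition _ := [SubChoice_isSubComNzRing of Zadjoin by <:].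

Local Open Scope classical_set_scope.

Definition Zadjoin_unit : {pred Zadjoin} :=
  fun x => `[< exists y, y * x = 1 >].

Definition Zadjoin_inv (x : Zadjoin) : Zadjoin :=
  xget x [set y | y * x = 1].

Lemma Zadjoin_mulVx : {in Zadjoin_unit, left_inverse 1 Zadjoin_inv *%R}.
Proof.
move=> x /asboolP[y yx1]; rewrite /Zadjoin_inv.
by case: xgetP => // /(_ y).
Qed.

Lemma Zadjoin_unitPl (x y : Zadjoin) : y * x = 1 -> Zadjoin_unit x.
Proof. by move=> yx1; apply/asboolP; exists y. Qed.

Lemma Zadjoin_inv_out : {in [predC Zadjoin_unit], Zadjoin_inv =1 id}.
Proof.
move=> x /asboolP nux; rewrite /Zadjoin_inv.
by case: xgetP => // y _ yx1; case: nux; exists y.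
Qed.

HB.instance Definition _ := GRing.ComNzRing_hasMulInverse.Build Zadjoin
  Zadjoin_mulVx Zadjoin_unitPl Zadjoin_inv_out.

Lemma Zadjoin_integral : GRing.integral_domain_axiom Zadjoin.
Proof.
move=> x y /(congr1 \val); rewrite rmorphM rmorph0 => /eqP.
by rewrite mulf_eq0 -!(rmorph0 (\val : Zadjoin -> C)) !(inj_eq val_inj).
Qed.

HB.instance Definition _ :=
  GRing.ComUnitRing_isIntegral.Build Zadjoin Zadjoin_integral.

Lemma Zadjoin_gen_subproof : theta \in in_Zadjoin.
Proof. by apply/asboolP; exists 'X; rewrite map_polyX hornerX. Qed.

Definition Zadjoin_gen : Zadjoin := InZadjoin Zadjoin_gen_subproof.

End Zadjoin.

(* Main.v *)
Require Import Defs.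
From mathcomp Require Import all_boot all_order all_fingroup all_algebra.
From mathcomp Require Import all_field.
From mathcomp Require Import boolp classical_sets.
From mathcomp Require Import zify ring.

(** The statement is the Latimer-MacDuffee correspondence between similarity
    classes of integral matrices and ideal classes, refined by identifying a
    matrix with its inverse; three points make it work.

    Irreducibility ([cs_irreducible]). If q is an irreducible factor of
    f = char_poly A with degree k at most n/2, then some rational row vector v
    is killed by q(A), and v, vA, ..., vA^(k-1) span an A-invariant subspace on
    which A acts by the companion matrix of q. Its determinant is 1 or -1,
    because q(0) divides f(0). The maximal minors of a basis of an invariant
    subspace form an eigenvector of the k-th exterior power, with the
    determinant of the restriction as eigenvalue: this is the Cauchy-Binet
    formula ([cauchy_binet], [det_exterior_power_eq0]). So 1 or -1 is an
    eigenvalue of the k-th exterior power M. The value 1 contradicts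
    det(I - M) being a unit, and so does -1, since I - M and -I - M agree
    modulo 2.

    The correspondence. Since f is irreducible, 1, theta, ..., theta^(n-1) is a
    basis of Z[theta]. If A v = theta v with v nonzero, then the entries of v
    are linearly independent over Z ([eigen_Zfree]): one nonzero entry together
    with the action of A already produces n independent combinations. Hence
    two eigenvectors are proportional ([eigen_proportional]), so the ideal class
    spanned by the entries depends only on the class of A. Conversely each
    nonzero ideal is a sublattice of finite index, so it has a basis with n
    elements ([full_lattice_basis], [ideal_Zbasis]); multiplication by theta in
    that basis is the matrix A, and a change of basis conjugates A.

    Inverses. The matrices with f*(A) = 0 are the inverses of those with
    f(A) = 0, so each class has a representative with f(A) = 0. It remains to
    see that two such representatives A and B are conjugate when A is conjugate
    to the inverse of B ([star_equiv_conj]). Then A is a root of both f and f*,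
    which forces f = f*. In odd degree at least 3 this gives f(1) = 0. In even
    degree at least 4 the eigenvectors for two roots a and 1/a span an invariant
    plane of determinant 1, which is excluded for k = 2. In degree 2,
    f = x^2 + b x + 1 with f(1) a unit, so b^2 - 4 is -3 or 5; reduction of
    binary quadratic forms with these discriminants shows that all roots of f
    are conjugate to one companion matrix, in particular A and B. *)

Set Implicit Arguments.
Unset Strict Implicit.
Unset Printing Implicit Defensive.

Import Order.TTheory GRing.Theory Num.Theory.
Local Open Scope ring_scope.

(** * Cauchy-Binet and eigenvectors of exterior powers *)

Section Plucker.
Variables (R : comNzRingType) (n k : nat).
Implicit Types (W : 'M[R]_(k, n)) (t : k.-tuple 'I_n).

Lemma det_rowsub_perm (A : 'M[R]_(n, k)) t (s : 'S_k) :
  \det (rowsub (tnth t \o s) A) = (-1) ^+ s * \det (rowsub (tnth t) A).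
Proof.
have -> : rowsub (tnth t \o s) A = row_perm s (rowsub (tnth t) A).
  by apply/matrixP => i j; rewrite !mxE.
by rewrite row_permE det_mulmx det_perm.
Qed.

Lemma det_rowsub_inj0 (A : 'M[R]_(n, k)) (g : 'I_k -> 'I_n) :
  ~~ injectiveb g -> \det (rowsub g A) = 0.
Proof.
case/injectivePn=> i [j nij gij].
by apply: (determinant_alternate nij) => l; rewrite !mxE gij.
Qed.

Lemma uniq_wedge_basis t : t \in wedge_basis n k -> uniq t.
Proof.
rewrite inE => st; rewrite -(map_inj_uniq val_inj).
exact: sorted_uniq ltn_trans ltnn _ st.
Qed.

Lemma wedge_basis_sort t :
  uniq t -> sort_tuple (fun i j : 'I_n => i <= j)%N t \in wedge_basis n k.
Proof.
move=> ut; rewrite inE ltn_sorted_uniq_leq map_inj_uniq ?sort_uniq ?ut //=.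
  by rewrite sorted_map; apply: sort_sorted => i j; apply: leq_total.
exact: val_inj.
Qed.

Lemma wedge_basis_perm_inj t t' :
  t \in wedge_basis n k -> t' \in wedge_basis n k -> perm_eq t t' -> t = t'.
Proof.
rewrite !inE => st st' tt'; apply/val_inj/(inj_map val_inj).
apply: (@irr_sorted_eq _ ltn ltn_trans ltnn) => // x.
exact: perm_mem (perm_map _ tt') x.
Qed.

(** Expanding each entry of the product turns the determinant into a sum over
    all maps from rows to columns. A map that is not injective repeats a row of
    A and contributes 0; an injective one is an increasing tuple followed by a
    permutation, whose sign turns the W factor into a determinant. *)
Theorem cauchy_binet W (A : 'M[R]_(n, k)) :
  \det (W *m A) =
  \sum_(t in wedge_basis n k)
     \det (colsub (tnth t) W) * \det (rowsub (tnth t) A).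
Proof.
pose G (f : {ffun 'I_k -> 'I_n}) := (\prod_i W i (f i)) * \det (rowsub f A).
have -> : \det (W *m A) = \sum_f G f.
  rewrite /determinant.
  under eq_bigr => s _.
    under eq_bigr => i _ do rewrite mxE.
    rewrite (bigA_distr_bigA (fun i j => W i j * A j (s i))) big_distrr /=.
    over.
  rewrite exchange_big; apply: eq_bigr => f _; rewrite /G /determinant.
  rewrite big_distrr; apply: eq_bigr => s _ /=.
  rewrite big_split /= mulrCA; congr (_ * (_ * _)).
  by apply: eq_bigr => i _; rewrite mxE.
pose ft (f : {ffun 'I_k -> 'I_n}) := [tuple f i | i < k].
pose srt f := sort_tuple (fun i j : 'I_n => i <= j)%N (ft f).
have uniq_ft f : uniq (ft f) = injectiveb f by [].
rewrite (bigID (fun f : {ffun _} => injectiveb f)) /=.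
rewrite [X in _ + X]big1 ?addr0; last first.
  by move=> f nf; rewrite /G det_rowsub_inj0 ?mulr0.
rewrite (partition_big srt (mem (wedge_basis n k))) /=; last first.
  by move=> f /=; rewrite -uniq_ft; apply: wedge_basis_sort.
apply: eq_bigr => t tW.
(* The injective maps that sort to t are the composites of t with a
   permutation. *)
pose h (s : 'S_k) := [ffun i => tnth t (s i)].
have ut := uniq_wedge_basis tW.
have t_inj : injective (tnth t) by apply/tuple_uniqP.
have h_inj : injective h.
  move=> s s' /ffunP ss'; apply/permP => i; apply: t_inj.
  by have := ss' i; rewrite !ffunE.
have ft_h s : ft (h s) = [tuple tnth t (s i) | i < k].
  by apply: eq_from_tnth => i; rewrite !tnth_mktuple ffunE.
rewrite [LHS](_ : _ = \sum_(f in h @: [set: 'S_k]) G f)%SET; last first.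
  apply: eq_bigl => f; apply/andP/imsetP => [[uf /eqP ft_t]|[s _ ->]].
    have /tuple_permP[s fs] : perm_eq (ft f) t.
      by rewrite -ft_t perm_sym perm_sort.
    exists s => //; apply/ffunP => i; rewrite ffunE.
    have := congr1 (fun u => nth (tnth t i) u i) fs.
    by rewrite -!tnth_nth !tnth_mktuple.
  have us : uniq (ft (h s)).
    rewrite (perm_uniq (_ : perm_eq _ t)) //; apply/tuple_permP.
    by exists s; rewrite ft_h.
  split; first by rewrite -uniq_ft.
  apply/eqP/wedge_basis_perm_inj => //; first exact: wedge_basis_sort.
  rewrite /srt perm_sort; apply/tuple_permP; by exists s; rewrite ft_h.
rewrite big_imset /=; last by move=> s s' _ _; apply: h_inj.
have -> : \det (colsub (tnth t) W) =
    \sum_(s : 'S_k) (-1) ^+ s * \prod_i W i (tnth t (s i)).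
  by apply: eq_bigr => s _; congr (_ * _); apply: eq_bigr => i _; rewrite mxE.
rewrite big_distrl /=; apply: eq_big => [s|s _]; first by rewrite inE.
rewrite /G -mulrA mulrCA -det_rowsub_perm; congr (_ * _).
  by apply: eq_bigr => i _; rewrite ffunE.
by congr (\det _); apply/matrixP => i j; rewrite !mxE ffunE.
Qed.

(** The coordinates of the wedge product of the rows of W in the basis indexed by
    [wedge_basis n k]. *)
Definition plucker W : 'rV[R]_#|wedge_basis n k| :=
  \row_i \det (colsub (tnth (enum_val i)) W).

Lemma plucker_mulr W (A : 'M[R]_n) :
  plucker (W *m A) = plucker W *m exterior_power k A.
Proof.
apply/rowP => j; rewrite !mxE.
have -> : colsub (tnth (enum_val j)) (W *m A) =
          W *m colsub (tnth (enum_val j)) A.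
  by apply/matrixP => a b; rewrite !mxE; apply: eq_bigr => c _; rewrite mxE.
rewrite cauchy_binet big_enum_val; apply: eq_bigr => i _; rewrite !mxE.
by congr (_ * \det _); apply/matrixP => a b; rewrite !mxE.
Qed.

Lemma plucker_mull (B : 'M[R]_k) W : plucker (B *m W) = \det B *: plucker W.
Proof.
apply/rowP => j; rewrite !mxE -det_mulmx; congr (\det _).
by apply/matrixP => a b; rewrite !mxE; apply: eq_bigr => c _; rewrite mxE.
Qed.

(** Cauchy-Binet writes the determinant 1 of the product of W with a right
    inverse as a combination of the maximal minors of W. *)
Lemma plucker_neq0 W (V : 'M[R]_(n, k)) : W *m V = 1%:M -> plucker W != 0.
Proof.
move=> WV; apply: contra_eq_neq (det1 R k) => W0; rewrite -WV cauchy_binet.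
rewrite big_enum_val big1 ?(eq_sym 0) ?oner_eq0 // => i _.
by have /rowP/(_ i) := W0; rewrite !mxE => ->; rewrite mul0r.
Qed.

End Plucker.

(** When the row space of W is invariant under A, the wedge product of the rows
    of W is a nonzero eigenvector of the exterior power, and its eigenvalue is
    the determinant of the action of A on that space. *)
Lemma det_exterior_power_eq0 (F : fieldType) (n k : nat) (A : 'M[F]_n)
    (B : 'M[F]_k) (W : 'M[F]_(k, n)) :
  row_free W -> W *m A = B *m W ->
  \det ((\det B)%:M - exterior_power k A) = 0.
Proof.
case/row_freeP=> V WV WA; apply/eqP/det0P; exists (plucker W).
  exact: plucker_neq0 WV.
by rewrite mulmxBr mul_mx_scalar -plucker_mulr WA plucker_mull subrr.
Qed.

Lemma map_exterior_power (R S : comNzRingType) (g : {rmorphism R -> S})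
    (n k : nat) (A : 'M[R]_n) :
  map_mx g (exterior_power k A) = exterior_power k (map_mx g A).
Proof. by apply/matrixP => i j; rewrite !mxE -det_map_mx map_mxsub. Qed.

(** * Irreducibility of Cappell-Shaneson polynomials *)

(** Over a domain that is not a field, the Bezout identity can only reach a
    nonzero constant c. Divisibility of polynomials is here up to constants, so
    an irreducible polynomial over the integers is one that is irreducible over
    the rationals. *)
Lemma irredp_Bezout (R : idomainType) (q p : {poly R}) :
  irreducible_poly q -> ~~ (q %| p) ->
  exists u w c, c != 0 /\ u * p + w * q = c%:P.
Proof.
case=> _ irr_q nqp.
have /Bezout_coprimepP[[u w] /= /eqp_size] : coprimep p q.
  rewrite /coprimep; apply: contraR nqp => /irr_q/(_ (dvdp_gcdr _ _)) Eq.
  by rewrite -(eqp_dvdl _ Eq) dvdp_gcdl.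
rewrite size_poly1 => /eqP/size_poly1P[c c0 Dc].
by exists u, w, c.
Qed.

Lemma irredp_Bezout_small (R : idomainType) (q p : {poly R}) :
  irreducible_poly q -> p != 0 -> (size p < size q)%N ->
  exists u w c, c != 0 /\ u * p + w * q = c%:P.
Proof.
move=> irr_q p0 sp; apply: irredp_Bezout => //; apply: contraL sp => qp.
by rewrite -leqNgt dvdp_leq.
Qed.

(** If p(a) = 0, then p(A) is a multiple of A - a, whose determinant is, up to
    sign, the value at a of the characteristic polynomial. *)
Lemma det_horner_mx_root (R : comNzRingType) (n : nat) (A : 'M[R]_n.+1)
    (p : {poly R}) (a : R) :
  root p a -> root (char_poly A) a -> \det (horner_mx A p) = 0.
Proof.
case/factor_theorem=> s -> /rootP chA.
rewrite rmorphM rmorphB /= horner_mx_X horner_mx_C det_mulmx.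
suff -> : \det (A - a%:M) = 0 by rewrite mulr0.
have -> : A - a%:M = (-1) *: (a%:M - A) by rewrite scaleN1r opprB.
rewrite detZ; suff -> : \det (a%:M - A) = (char_poly A).[a].
  by rewrite chA mulr0.
rewrite /char_poly -/(horner_eval a _) -det_map_mx; congr (\det _).
apply/matrixP=> i j; rewrite !mxE /= horner_evalE.
by rewrite hornerD hornerN hornerC hornerMn hornerX.
Qed.

Lemma map_mx_injective (aT rT : Type) (g : aT -> rT) (m n : nat) :
  injective g -> injective (map_mx g : 'M_(m, n) -> 'M_(m, n)).
Proof.
move=> g_inj M N /matrixP MN; apply/matrixP => i j; apply: g_inj.
by have := MN i j; rewrite !mxE.
Qed.

Section Krylov.
Variables (R : comNzRingType) (n : nat) (A : 'M[R]_n.+1) (v : 'rV[R]_n.+1).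

(** The rows are v, v A, ..., v A^(d-1). Over a field they form a basis of the
    cyclic subspace of a nonzero v when some irreducible polynomial of degree d
    in A kills v. *)
Definition krylov d : 'M[R]_(d, n.+1) := \matrix_i (v *m horner_mx A 'X^i).

(** Combinations of the rows are values at v of polynomials in A of degree less
    than d; this is how linear algebra over the cyclic module becomes
    arithmetic of polynomials. *)
Lemma mulmx_krylov d (c : 'rV_d) :
  c *m krylov d = v *m horner_mx A (rVpoly c).
Proof.
pose F i := v *m horner_mx A ((rVpoly c)`_i *: 'X^i).
rewrite mulmx_sum_row -[rVpoly c]coefK poly_def rmorph_sum mulmx_sumr.
rewrite (big_ord_widen d F) ?size_poly //= [RHS]big_mkcond.
apply: eq_bigr => i _; rewrite rowK /F; case: ifP => [_|].
  by rewrite linearZ /= -scalemxAr coef_rVpoly_ord.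
move/negbT; rewrite -leqNgt => /(nth_default 0); rewrite coef_rVpoly_ord => ->.
by rewrite scale0r.
Qed.

Lemma krylov_companion (q : {poly R}) :
  q \is monic -> v *m horner_mx A q = 0 ->
  krylov (size q).-1 *m A = companionmx q *m krylov (size q).-1.
Proof.
move=> q_monic v_q; apply/row_matrixP => i; rewrite !row_mul mulmx_krylov rowK.
have q0 := monic_neq0 q_monic.
rewrite -mulmxA -{2}(horner_mx_X A) mulmxE -rmorphM -exprSr.
have lt_q : ((size q).-1 < size q)%N by rewrite prednK // size_poly_gt0.
have [Ei|Ni] := eqVneq (i : nat) (size q).-1.-1; last first.
  congr (v *m horner_mx A _); apply/polyP => j; rewrite coefXn coef_rVpoly.
  case: insubP => [k _ <-|]; first by rewrite !mxE (negPf Ni) eq_sym.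
  case: eqP => // ->; case/negP; rewrite ltn_neqAle ltn_ord andbT.
  by apply: contra Ni => /eqP/(congr1 predn) /= ->.
have -> : 'X^(i.+1) = rVpoly (row i (companionmx q)) + q.
  have Si : i.+1 = (size q).-1.
    by rewrite [in LHS]Ei prednK ?(leq_ltn_trans _ (ltn_ord i)).
  apply/polyP => j; rewrite coefD coefXn coef_rVpoly Si.
  case: insubP => [k _ <-|].
    by rewrite !mxE Ei eqxx addNr ltn_eqF ?ltn_ord.
  rewrite -leqNgt leq_eqVlt add0r => /predU1P[<-|lt_j].
    by rewrite eqxx -lead_coefE (monicP q_monic).
  rewrite gtn_eqF // nth_default // -(prednK (_ : 0 < size q)%N) //.
  by rewrite size_poly_gt0.
by rewrite rmorphD mulmxDr v_q addr0.
Qed.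

End Krylov.

(** A relation between the rows is a nonzero polynomial of small degree in A
    that kills v. It is coprime to the irreducible q, which kills v too, so
    Bezout gives a nonzero constant that kills v. *)
Lemma krylov_free (R : idomainType) (n : nat) (A : 'M[R]_n.+1)
    (v : 'rV[R]_n.+1) (q : {poly R}) d (c : 'rV_d) :
  irreducible_poly q -> v *m horner_mx A q = 0 -> v != 0 ->
  (d < size q)%N -> c *m krylov A v d = 0 -> c = 0.
Proof.
move=> q_irr v_q v0 lt_d; rewrite mulmx_krylov => vc0.
apply: (can_inj rVpolyK); rewrite linear0; apply: contraNeq v0 => c0.
have lt_c := leq_ltn_trans (size_poly _ _ : size (rVpoly c) <= d)%N lt_d.
have [u [w [a [a0 /(congr1 (horner_mx A))]]]] :=
  irredp_Bezout_small q_irr c0 lt_c.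
rewrite horner_mx_C rmorphD !rmorphM /= => /(congr1 (mulmx v)).
rewrite mulmxDr mul_mx_scalar -!mulmxE.
rewrite -[horner_mx A u *m _](comm_horner_mx2).
rewrite -[horner_mx A w *m _](comm_horner_mx2).
rewrite !mulmxA vc0 v_q !mul0mx addr0 => /esym avs.
apply/eqP/rowP => i; have /rowP/(_ i) := avs; rewrite !mxE => /eqP.
by rewrite mulf_eq0 (negPf a0) => /eqP.
Qed.

Section CappellShaneson.
Variables (n : nat) (A : 'M[int]_n).
Hypothesis csA : cappell_shaneson_mx A.

Lemma cs_char_poly_coef0 : (char_poly A)`_0 = (-1) ^+ n.
Proof. by rewrite char_poly_det csA.1 mulr1. Qed.

Section Invariant.
Variables (F : fieldType) (k : nat) (B : 'M[F]_k) (W : 'M[F]_(k, n)).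
Hypotheses (k_range : (1 <= k <= n./2)%N) (freeW : row_free W).
Hypothesis (WA : W *m map_mx intr A = B *m W).

Lemma cs_det_invariant_neq1 : \det B != 1.
Proof.
apply/eqP => B1; have := det_exterior_power_eq0 freeW WA.
rewrite B1 -map_exterior_power -(map_mx1 (intr : int -> F)) -map_mxB.
rewrite det_map_mx /=.
by case: (csA.2 k k_range) => -> /eqP; rewrite ?rmorphN ?oppr_eq0 oner_eq0.
Qed.

(** If -1 were an eigenvalue of the exterior power M, then det(-1 - M) = 0; but
    this is congruent modulo 2 to det(1 - M), which is odd. *)
Lemma cs_det_invariant_neqN1 : injective (intr : int -> F) -> \det B != -1.
Proof.
move=> injF; apply/eqP => BN1; have := det_exterior_power_eq0 freeW WA.
rewrite BN1 -map_exterior_power -(rmorphN1 (intr : int -> F)) -map_scalar_mx.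
rewrite -map_mxB det_map_mx /= -[RHS](rmorph0 (intr : int -> F)) => /injF.
move/(congr1 (intr : int -> 'F_2)); rewrite -det_map_mx map_mxB map_scalar_mx.
rewrite rmorphN1 (_ : - 1 = 1 :> 'F_2); last exact: val_inj.
rewrite -(map_mx1 (intr : int -> 'F_2)) -map_mxB det_map_mx.
by case: (csA.2 k k_range) => ->.
Qed.

End Invariant.
End CappellShaneson.

Lemma mulr_eq1_int (a b : int) : a * b = 1 -> (a == 1) || (a == -1).
Proof.
by move=> ab; rewrite -[_ || _]/(a \is a GRing.unit); apply/unitrPr; exists b.
Qed.

(** A common complex root of q and of the characteristic polynomial makes q(A)
    singular, so q(A) kills some nonzero row vector v. The cyclic space of v is
    invariant, A acts on it by the companion matrix of q, and the determinant
    of that matrix is, up to sign, q(0), a unit. *)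
Lemma cs_no_small_factor (n : nat) (A : 'M[int]_n.+1) (q r : {poly int}) :
  cappell_shaneson_mx A -> char_poly A = q * r -> q \is monic ->
  irreducible_poly q -> (n.+1./2 < (size q).-1)%N.
Proof.
move=> csA Dch q_monic irr_q; rewrite ltnNge; apply/negP => le_q.
have q_gt1 : (1 < size q)%N := irr_q.1.
have /eqP/det0P[v v0 vq] : \det (horner_mx A q) = 0.
  have [a qa] : exists a, root (map_poly (intr : int -> algC) q) a.
    apply/closed_rootP; rewrite size_map_poly_id0 ?gtn_eqF //.
    by rewrite (monicP q_monic) rmorph1 oner_eq0.
  apply: (@intr_inj algC); rewrite -det_map_mx map_horner_mx rmorph0.
  apply: (det_horner_mx_root qa).
  by rewrite -map_char_poly Dch rmorphM rootM qa.
pose Q := map_poly (intr : int -> rat) q.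
have Q_monic : Q \is monic by rewrite monic_map.
have irr_Q : irreducible_poly Q by apply/irreducible_rat_int.
pose V := map_mx (intr : int -> rat) v; pose AQ := map_mx (intr : int -> rat) A.
have V0 : V != 0.
  apply: contra_neq v0 => V0; apply: (map_mx_injective (@intr_inj rat)).
  by rewrite map_mx0.
have VQ : V *m horner_mx AQ Q = 0.
  by rewrite -map_horner_mx -map_mxM vq map_mx0.
have freeK : row_free (krylov AQ V (size Q).-1).
  apply: inj_row_free => c; apply: krylov_free irr_Q VQ V0 _.
  by rewrite prednK // size_poly_gt0 monic_neq0.
have KA := krylov_companion Q_monic VQ.
have sQ : size Q = size q.
  by rewrite size_map_poly_id0 // (monicP q_monic) rmorph1 oner_eq0.
have k_range : (1 <= (size Q).-1 <= n.+1./2)%N.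
  by rewrite sQ le_q -subn1 subn_gt0 q_gt1.
have N1 := cs_det_invariant_neq1 csA k_range freeK KA.
have NN1 := cs_det_invariant_neqN1 csA k_range freeK KA (@intr_inj rat).
have : Q`_0 = (-1) ^+ (size Q).-1 * \det (companionmx Q).
  by rewrite -char_poly_det companionmxK.
have qr : q`_0 * ((-1) ^+ n.+1 * r`_0) = 1.
  have /(congr1 (fun p : {poly int} => (-1) ^+ n.+1 * p`_0)) := Dch.
  rewrite cs_char_poly_coef0 // -expr2 sqrr_sign => E.
  by rewrite mulrCA -coef0M -E.
move/(canLR (signrMK _)).
have /orP[] := mulr_eq1_int qr; rewrite /Q coef_map /= => /eqP ->.
  rewrite rmorph1 mulr1 -signr_odd => E; move: N1 NN1; rewrite -E.
  by case: (odd _); rewrite ?eqxx.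
rewrite rmorphN1 mulrN1 -signr_odd => E; move: N1 NN1; rewrite -E.
by case: (odd _); rewrite ?opprK ?eqxx.
Qed.

(** Otherwise a divisor of least positive degree is a proper irreducible factor,
    and so is at most as large as its cofactor: its degree is at most half of
    the degree of f. Gauss's lemma makes it monic with integer coefficients. *)
Lemma cs_irreducible (n : nat) (f : {poly int}) :
  cappell_shaneson_poly n.+1 f -> irreducible_poly f.
Proof.
case=> A csA Df; have f_monic : f \is monic by rewrite Df char_poly_monic.
have f0 := monic_neq0 f_monic.
have sf : size f = n.+2 by rewrite Df size_char_poly.
have ex_q : exists d,
    `[< exists q : {poly int}, [/\ q %| f, size q = d & (1 < d)%N] >].
  by exists (size f); apply/asboolP; exists f; rewrite sf dvdpp.
case: (ex_minnP ex_q) => d /asboolP[q [qf sq d_gt1]] min_d.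
have small_div p : p %| f -> size p != 1%N -> (d <= size p)%N.
  move=> pf sp; apply: min_d; apply/asboolP; exists p; split => //.
  have : (0 < size p)%N by rewrite size_poly_gt0 (dvdpN0 pf).
  by case: (size p) sp => [|[]].
have [lt_d|] := ltnP d (size f); last first.
  move=> le_d; split=> [|p sp pf]; first by rewrite sf.
  rewrite -dvdp_size_eqp // eqn_leq dvdp_leq //.
  by rewrite (leq_trans le_d) // small_div.
exfalso; case: (dvdpP_int qf) => r Dr.
pose s := lead_coef (zprimitive q).
have Ds : s * lead_coef r = 1 by rewrite -lead_coefM -Dr (monicP f_monic).
have ss : s * s = 1.
  by have /orP[/eqP->|/eqP->] := mulr_eq1_int Ds.
have s0 : s != 0 by apply/eqP => E; move: Ds; rewrite E mul0r.
(* By Gauss's lemma f is the product of the primitive part of q and some r; the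
   sign s makes both factors monic. *)
pose q' := s *: zprimitive q; pose r' := s *: r.
have Df' : f = q' * r' by rewrite -scalerAl -scalerAr scalerA ss scale1r.
have q'_monic : q' \is monic by rewrite monicE lead_coefZ ss.
have sq' : size q' = d by rewrite size_scale // size_zprimitive.
have q'f : q' %| f by rewrite Df' dvdp_mulr.
have irr_q' : irreducible_poly q'.
  split=> [|p sp pq]; first by rewrite sq'.
  rewrite -dvdp_size_eqp // eqn_leq dvdp_leq ?monic_neq0 //= sq'.
  by rewrite small_div // (dvdp_trans pq).
have q'0 := monic_neq0 q'_monic.
have r'0 : r' != 0 by apply: contraNneq f0 => E; rewrite Df' E mulr0.
have := cs_no_small_factor csA (etrans (esym Df) Df') q'_monic irr_q'.
have := sf; rewrite {1}Df' size_mul // sq'.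
have : (d <= size r')%N.
  apply: small_div; first by rewrite Df' dvdp_mull.
  apply: contraL lt_d => /eqP sr.
  by rewrite -leqNgt Df' size_mul // sr sq' addn1.
move: d_gt1; case: d {min_d small_div lt_d sq sq'} => // d _.
rewrite addSn /= => le_d E.
have : (d.*2 <= n.+1)%N by rewrite -ltnS -E -addnn ltn_add2l.
move=> le2; rewrite ltnNge => /negP; case; apply: leq_trans (half_leq le2).
by rewrite doubleK.
Qed.

(** * Eigenvectors and conjugation *)

Lemma horner_mx_eigen (R : comNzRingType) (n : nat) (A : 'M[R]_n.+1)
    (v : 'cV[R]_n.+1) (a : R) (p : {poly R}) :
  A *m v = a *: v -> horner_mx A p *m v = p.[a] *: v.
Proof.
move=> Av; elim/poly_ind: p => [|p c IHp].
  by rewrite rmorph0 mul0mx horner0 scale0r.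
rewrite rmorphD rmorphM /= horner_mx_X horner_mx_C mulmxDl mul_scalar_mx.
rewrite -mulmxE -mulmxA Av -scalemxAr IHp scalerA hornerD hornerMX hornerC.
by rewrite mulrC scalerDl.
Qed.

Lemma conj_unitmx (R : comUnitRingType) (n : nat) (A B P : 'M[R]_n) :
  P \in unitmx -> A *m P = P *m B -> A = P *m B *m invmx P.
Proof. by move=> uP <-; rewrite mulmxK. Qed.

(** * Bases of lattices and of spans *)

Lemma int_subgroup_gen (I : int -> Prop) :
  I 0 -> (forall a b, I a -> I b -> I (a - b)) ->
  exists2 d, I d & forall a, I a -> exists q, a = q * d.
Proof.
move=> I0 IB.
have IN a : I a -> I (- a) by rewrite -sub0r; apply: IB.
have ID a b : I a -> I b -> I (a + b).
  by move=> Ia Ib; rewrite -[b]opprK; apply: IB => //; apply: IN.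
have IM q a : I a -> I (q * a).
  move=> Ia; have In k : I (k%:Z * a).
    by elim: k => [|k IHk]; rewrite ?mul0r // intS mulrDl mul1r; apply: ID.
  by case: q => [k|k]; rewrite ?NegzE ?mulNr //; apply: IN.
have [[a Ia a0]|nI] := pselect (exists2 a, I a & a != 0); last first.
  exists 0 => // a Ia; exists 0; rewrite mul0r; apply/eqP/negPn/negP => a0.
  by apply: nI; exists a.
have ex_d : exists d, (0 < d)%N && `[< I d%:Z >].
  exists `|a|%N; rewrite absz_gt0 a0; apply/asboolP; rewrite abszE.
  by case: (ger0P a) => _; [|apply: IN].
case: (ex_minnP ex_d) => d /andP[d_gt0 /asboolP Id] min_d.
exists d%:Z => // b Ib; exists (b %/ d)%Z; rewrite {1}(divz_eq b d).
suff -> : (b %% d)%Z = 0 by rewrite addr0.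
have Ir : I (b %% d)%Z.
  have -> : (b %% d)%Z = b - (b %/ d)%Z * d.
    by rewrite {2}(divz_eq b d) addrC addKr.
  by apply: IB => //; apply: IM.
have r_ge0 : 0 <= (b %% d)%Z by rewrite modz_ge0 // -lt0n.
have r_lt : (b %% d)%Z < d by rewrite ltz_pmod.
case: (b %% d)%Z r_ge0 r_lt Ir => // r _; rewrite ltz_nat => r_lt Ir.
case: r r_lt Ir => // r r_lt Ir; suff : (d <= r.+1)%N by rewrite leqNgt r_lt.
by apply: min_d; apply/asboolP.
Qed.

(** Triangular elimination: the possible first coordinates of the vectors of L
    form a subgroup of the integers, generated by some d realized by a vector
    (d, b), and the vectors with first coordinate 0 form a lattice of smaller
    rank. Containing the multiples of a nonzero N keeps each d nonzero. *)
Lemma full_lattice_basis (m : nat) (L : 'rV[int]_m -> Prop) (N : int) :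
  (forall a b, L a -> L b -> L (a - b)) -> N != 0 -> (forall c, L (N *: c)) ->
  exists2 B : 'M_m, \det B != 0 & forall c, L c <-> exists y, c = y *m B.
Proof.
move=> LB N0; elim: m L LB => [|m IHm]; first move=> L LB LN.
  exists 1%:M; first by rewrite det1.
  move=> c; split=> [_|[y _]]; first by exists c; rewrite mulmx1.
  by have := LN 0; rewrite scaler0 [c]thinmx0.
rewrite -[m.+1]/(1 + m)%N => L LB LN.
have L0 : L 0 by have := LN 0; rewrite scaler0.
have LD a b : L a -> L b -> L (a + b).
  move=> La Lb; rewrite -[b]opprK; apply: (LB) => //.
  by rewrite -sub0r; apply: LB.
have LZ q a : L a -> L (q *: a).
  move=> La; have In k : L (k%:Z *: a).
    by elim: k => [|k IHk]; rewrite ?scale0r // intS scalerDl scale1r; apply: LD.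
  case: q => [k|k]; first exact: In.
  by rewrite NegzE scaleNr -sub0r; apply: LB.
have [B0 detB0 LB0] : exists2 B : 'M_m, \det B != 0 &
    forall c, L (row_mx (0 : 'rV_1) c : 'rV_(1 + m)) <-> exists y, c = y *m B.
  apply: IHm => [a b La Lb|c].
    by have := LB _ _ La Lb; rewrite opp_row_mx add_row_mx subr0.
  by have := LN (row_mx 0 c : 'rV_(1 + m)); rewrite scale_row_mx scaler0.
pose I a := exists y : 'rV_m, L (row_mx (a%:M : 'M_1) y : 'rV_(1 + m)).
have [d [b Ld] gen_d] : exists2 d, I d & forall a, I a -> exists q, a = q * d.
  apply: int_subgroup_gen.
    by exists 0; rewrite raddf0 row_mx0.
  move=> a b [y Ly] [z Lz]; exists (y - z).
  by have := LB _ _ Ly Lz; rewrite opp_row_mx add_row_mx -raddfB.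
have d0 : d != 0.
  have [|q Nqd] := gen_d N.
    exists 0; have := LN (row_mx (1%:M : 'M_1) 0 : 'rV_(1 + m)).
    by rewrite scale_row_mx scaler0 scalemx1.
  by apply: contra_neq N0 => d0; rewrite Nqd d0 mulr0.
pose B : 'M_(1 + m) := block_mx (d%:M : 'M_1) b 0 B0.
exists B => [|c]; first by rewrite det_ublock det_scalar1 mulf_neq0.
have mulB (q : int) y :
    (row_mx (q%:M : 'M_1) y : 'rV_(1 + m)) *m B =
    q *: row_mx (d%:M : 'M_1) b + row_mx 0 (y *m B0).
  rewrite mul_row_block mulmx0 addr0 !mul_scalar_mx scale_row_mx add_row_mx.
  by rewrite addr0.
split=> [|[y ->]]; last first.
  rewrite -[y : 'rV_(1 + m)]hsubmxK [lsubmx _]mx11_scalar mulB.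
  by apply: LD; [apply: LZ | apply/LB0; exists (rsubmx (y : 'rV_(1 + m)))].
rewrite -[c : 'rV_(1 + m)]hsubmxK [lsubmx _]mx11_scalar.
set a := lsubmx _ 0 0; set y := rsubmx _ => Lc.
have [|q Da] := gen_d a; first by exists y.
have /LB0[z Dz] : L (row_mx (0 : 'rV_1) (y - q *: b) : 'rV_(1 + m)).
  have := LB _ _ Lc (LZ q _ Ld); rewrite scale_row_mx opp_row_mx add_row_mx.
  by rewrite scale_scalar_mx -Da subrr.
exists (row_mx (q%:M : 'M_1) z : 'rV_(1 + m)); rewrite mulB -Dz scale_row_mx.
by rewrite add_row_mx scale_scalar_mx -Da addr0 addrC subrK.
Qed.

Section ZModules.
Variable R : idomainType.
Local Open Scope classical_set_scope.
Local Notation iR := (map_mx (intr : int -> R)).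

Lemma Zcomb_mx (m : nat) (v : 'cV[R]_m) (c : 'rV[int]_m) :
  iR c *m v = (\sum_i v i 0 *~ c 0 i)%:M.
Proof.
rewrite [LHS]mx11_scalar mxE; congr (_%:M); apply: eq_bigr => i _.
by rewrite mxE mulrzl.
Qed.

(** Turns membership in the span into a matrix equation, so that changes of
    generators become matrix products. *)
Lemma ZspanE (m : nat) (v : 'cV[R]_m) (x : R) :
  Zspan v x <-> exists c : 'rV[int]_m, x%:M = iR c *m v.
Proof.
split=> [[c ->]|[c]].
  exists (\row_i c i); rewrite Zcomb_mx; congr (_%:M).
  by apply: eq_bigr => i _; rewrite mxE.
rewrite Zcomb_mx => /(congr1 (fun M : 'M_1 => M 0 0)); rewrite !mxE eqxx !mulr1n.
by move=> ->; exists (fun i => c 0 i).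
Qed.

Definition Zfree (m : nat) (v : 'cV[R]_m) :=
  forall c : 'rV[int]_m, iR c *m v = 0 -> c = 0.

Lemma is_ZbasisE (S : set R) (m : nat) (v : 'cV[R]_m) :
  is_Zbasis S v <-> S = Zspan v /\ Zfree v.
Proof.
split=> -[SE free_v]; split=> // c.
  rewrite Zcomb_mx => /(congr1 (fun M : 'M_1 => M 0 0)); rewrite !mxE mulr1n.
  by move=> /free_v c0; apply/rowP => i; rewrite mxE c0.
move=> c0 i; have := free_v (\row_i c i); rewrite Zcomb_mx.
under eq_bigr do rewrite mxE.
by rewrite c0 raddf0 => /(_ erefl)/rowP/(_ i); rewrite !mxE.
Qed.

Lemma Zfree_mx (m k : nat) (v : 'cV[R]_m) (M : 'M[int]_(k, m)) :
  Zfree v -> iR M *m v = 0 -> M = 0.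
Proof.
move=> free_v Mv0; apply/row_matrixP => i; rewrite row0; apply: free_v.
by rewrite map_row -row_mul Mv0 row0.
Qed.

Lemma Zfree_mx_inj (m k : nat) (v : 'cV[R]_m) (M N : 'M[int]_(k, m)) :
  Zfree v -> iR M *m v = iR N *m v -> M = N.
Proof.
move=> free_v MN; apply/eqP; rewrite -subr_eq0; apply/eqP/(Zfree_mx free_v).
by rewrite map_mxB mulmxBl MN subrr.
Qed.

Lemma Zspan_entry (m : nat) (v : 'cV[R]_m) i : Zspan v (v i 0).
Proof.
apply/ZspanE; exists (delta_mx 0 i); rewrite map_delta_mx -rowE.
by apply/matrixP => a b; rewrite !mxE !ord1 eqxx mulr1n.
Qed.

Lemma Zspan_sub_mx (m k : nat) (v : 'cV[R]_m) (w : 'cV[R]_k) :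
  (forall i, Zspan v (w i 0)) -> exists P : 'M[int]_(k, m), w = iR P *m v.
Proof.
move=> vw.
have /choice[c wc] i : exists c : 'rV[int]_m, (w i 0)%:M = iR c *m v.
  exact/ZspanE.
exists (\matrix_i c i); apply/row_matrixP => i; rewrite row_mul -map_row rowK.
by rewrite -wc; apply/rowP => j; rewrite !mxE !ord1 mulr1n.
Qed.

Lemma Zspan_mulmx_sub (m k : nat) (v : 'cV[R]_m) (P : 'M[int]_(k, m)) :
  Zspan (iR P *m v) `<=` Zspan v.
Proof.
move=> x /ZspanE[c xc]; apply/ZspanE; exists (c *m P).
by rewrite map_mxM -mulmxA.
Qed.

Lemma Zspan_unitmx (m : nat) (v : 'cV[R]_m) (P : 'M[int]_m) :
  P \in unitmx -> Zspan (iR P *m v) = Zspan v.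
Proof.
move=> uP; apply/seteqP; split; first exact: Zspan_mulmx_sub.
have {1}-> : v = iR (invmx P) *m (iR P *m v); last exact: Zspan_mulmx_sub.
by rewrite mulmxA -map_mxM mulVmx // map_mx1 mul1mx.
Qed.

(** Each family is an integral combination of the other, and independence of v
    makes the two matrices of coefficients inverse to each other. *)
Lemma Zspan_eq_unitmx (m : nat) (v w : 'cV[R]_m) :
  Zfree v -> Zspan v = Zspan w ->
  exists2 P : 'M[int]_m, P \in unitmx & v = iR P *m w.
Proof.
move=> free_v vw.
have [|P Dv] := @Zspan_sub_mx _ _ w v; first by rewrite -vw; apply: Zspan_entry.
have [|Q Dw] := @Zspan_sub_mx _ _ v w; first by rewrite vw; apply: Zspan_entry.
exists P => //; suff /mulmx1_unit[] : P *m Q = 1%:M by [].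
apply: (Zfree_mx_inj free_v).
by rewrite map_mxM -mulmxA -Dw -Dv map_mx1 mul1mx.
Qed.

Lemma Zspan_scale (m : nat) (a : R) (v : 'cV[R]_m) :
  Zspan (a *: v) = [set a * x | x in Zspan v].
Proof.
apply/seteqP; split=> [_ [c ->]|_ [_ [c ->] <-]].
  exists (\sum_i v i 0 *~ c i); first by exists c.
  by rewrite mulr_sumr; apply: eq_bigr => i _; rewrite mxE mulrzAr.
by exists c; rewrite mulr_sumr; apply: eq_bigr => i _; rewrite mxE mulrzAr.
Qed.

Lemma Zfree_scale (m : nat) (a : R) (v : 'cV[R]_m) :
  a != 0 -> Zfree v -> Zfree (a *: v).
Proof.
move=> a0 free_v c; rewrite -scalemxAr => /eqP acv; apply: free_v.
apply/rowP => i; have /eqP/rowP/(_ i)/eqP := acv; rewrite !mxE mulf_eq0.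
by rewrite (negPf a0) => /eqP.
Qed.

Lemma Zspan_nonzero_ideal (n : nat) (t : R) (v : 'cV[R]_n.+1) (A : 'M_n.+1) :
  (forall x, exists p : {poly int}, x = (map_poly intr p).[t]) ->
  v != 0 -> iR A *m v = t *: v -> is_nonzero_ideal (Zspan v).
Proof.
move=> gen_t v0 Av; split.
- by apply/ZspanE; exists 0; rewrite map_mx0 mul0mx raddf0.
- move=> x y /ZspanE[c xc] /ZspanE[d yd]; apply/ZspanE; exists (c + d).
  by rewrite map_mxD mulmxDl -xc -yd raddfD.
- move=> a x /ZspanE[c xc]; apply/ZspanE; have [p ->] := gen_t a.
  exists (c *m horner_mx A p); rewrite map_mxM map_horner_mx -mulmxA.
  by rewrite (horner_mx_eigen _ Av) -scalemxAr -xc scale_scalar_mx.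
- have [i vi0] : exists i, v i 0 != 0.
    apply/not_existsP => v_i; move/eqP: v0; apply; apply/colP => i; rewrite mxE.
    by apply/eqP/negPn/negP/v_i.
  by exists (v i 0) => //; apply: Zspan_entry.
Qed.

End ZModules.

(** * Eigenvectors with entries in the ring generated by a root *)

Section LatimerMacDuffee.
Variables (R : idomainType) (t : R) (n : nat) (f : {poly int}).
Local Notation iR := (map_mx (intr : int -> R)).
Local Notation ev p := (map_poly (intr : int -> R) p).[t].

Hypothesis int_inj : injective (intr : int -> R).
Hypothesis gen_t : forall x : R, exists p : {poly int}, x = ev p.
Hypotheses (f_monic : f \is monic) (f_irr : irreducible_poly f).
Hypotheses (size_f : size f = n.+2) (f_t : root (map_poly intr f) t).

Lemma ev_modp (p : {poly int}) : ev (p %% f) = ev p.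
Proof.
rewrite [in RHS](Pdiv.IdomainMonic.divp_eq f_monic p) rmorphD rmorphM /=.
by rewrite hornerD hornerM (rootP f_t) mulr0 add0r.
Qed.

Lemma size_modp_f (p : {poly int}) : (size (p %% f)%R <= n.+1)%N.
Proof. by rewrite -ltnS -size_f ltn_modp monic_neq0. Qed.

Lemma ev_Bezout (p : {poly int}) :
  ~~ (f %| p) -> exists u c, c != 0 /\ ev u * ev p = c%:~R.
Proof.
move=> nfp; have [u [w [c [c0 E]]]] := irredp_Bezout f_irr nfp.
exists u, c; split=> //; have := congr1 (fun q : {poly int} => ev q) E.
rewrite rmorphD !rmorphM /= hornerD !hornerM (rootP f_t) mulr0 addr0 => ->.
by rewrite map_polyC hornerC.
Qed.

Lemma ev_eq0 (p : {poly int}) : ev p = 0 -> f %| p.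
Proof.
move=> p0; apply/negPn/negP => /ev_Bezout[u [c [c0 E]]]; case/eqP: c0.
by apply: int_inj; rewrite -E p0 mulr0.
Qed.

Lemma ev_eq0_small (p : {poly int}) : (size p <= n.+1)%N -> ev p = 0 -> p = 0.
Proof.
move=> sp /ev_eq0 fp; apply: contraTeq sp => p0.
by rewrite -ltnNge -size_f dvdp_leq.
Qed.

Lemma ev_rVpoly_eq0 (c : 'rV_n.+1) : ev (rVpoly c) = 0 -> c = 0.
Proof.
move=> c0; apply: (can_inj rVpolyK); rewrite linear0.
by apply: ev_eq0_small c0; apply: size_poly.
Qed.

Lemma ev_rVpoly (x : R) : exists c : 'rV_n.+1, x = ev (rVpoly c).
Proof.
have [p ->] := gen_t x; exists (poly_rV (p %% f)).
by rewrite poly_rV_K ?size_modp_f // ev_modp.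
Qed.

(** This takes the place of the norm: Bezout for f and a polynomial that
    represents x. *)
Lemma int_multiple (x : R) : x != 0 -> exists y c, c != 0 /\ y * x = c%:~R.
Proof.
have [p ->] := gen_t x => p0; have [|u [c E]] := @ev_Bezout p.
  apply: contra p0 => /modp_eq0P fp.
  by rewrite -ev_modp fp rmorph0 horner0.
by exists (ev u), c.
Qed.

(** For a nonzero entry v_j, the combinations e_j A^i v are the elements t^i v_j,
    which are independent. So the matrix K with rows e_j A^i has nonzero
    determinant, and each integral row vector is, up to the factor det K, a
    combination of the rows of K, where independence is known. *)
Lemma eigen_Zfree (A : 'M[int]_n.+1) (v : 'cV[R]_n.+1) :
  v != 0 -> iR A *m v = t *: v -> Zfree v.
Proof.
move=> v0 Av.
have [j vj0] : exists j, v j 0 != 0.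
  apply/not_existsP => v_i; move/eqP: v0; apply; apply/colP => i; rewrite mxE.
  by apply/eqP/negPn/negP/v_i.
pose K := krylov A (delta_mx 0 j) n.+1.
have Kv y : iR (y *m K) *m v = (ev (rVpoly y) * v j 0)%:M.
  rewrite mulmx_krylov map_mxM map_horner_mx -mulmxA (horner_mx_eigen _ Av).
  rewrite -scalemxAr map_delta_mx -rowE [row _ _]mx11_scalar mxE.
  by rewrite scale_scalar_mx.
have K_inj (y : 'rV_n.+1) : iR (y *m K) *m v = 0 -> y = 0.
  rewrite Kv => /(congr1 (fun M : 'M_1 => M 0 0)); rewrite !mxE mulr1n => /eqP.
  by rewrite mulf_eq0 (negPf vj0) orbF => /eqP/ev_rVpoly_eq0.
have detK : \det K != 0.
  apply/det0P => -[y y0 yK]; case/eqP: y0; apply: K_inj.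
  by rewrite yK map_mx0 mul0mx.
move=> c cv; have : c *m \adj K = 0.
  apply: K_inj; rewrite -mulmxA mul_adj_mx mul_mx_scalar map_mxZ -scalemxAl cv.
  by rewrite scaler0.
move/(congr1 (mulmx^~ K)); rewrite -mulmxA mul_adj_mx mul_mx_scalar mul0mx.
move=> /rowP cK; apply/rowP => i; have /eqP := cK i; rewrite !mxE mulf_eq0.
by rewrite (negPf detK) => /eqP.
Qed.

Lemma Zfree_neq0 (v : 'cV[R]_n.+1) : Zfree v -> v != 0.
Proof.
move=> free_v; apply/eqP => v0; have := free_v (delta_mx 0 0).
rewrite v0 mulmx0 => /(_ erefl)/rowP/(_ 0)/eqP.
by rewrite !mxE eqxx oner_eq0.
Qed.

Lemma eigen_horner_mx_eq0 (A : 'M[int]_n.+1) (v : 'cV[R]_n.+1) :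
  Zfree v -> iR A *m v = t *: v -> horner_mx A f = 0.
Proof.
move=> free_v Av; apply: (Zfree_mx free_v).
by rewrite map_horner_mx (horner_mx_eigen _ Av) (rootP f_t) scale0r.
Qed.

(** The vector w_0 v - v_0 w is killed by t - A and has first entry 0, whereas the
    entries of a nonzero eigenvector are independent, in particular nonzero. *)
Lemma eigen_proportional (A : 'M[int]_n.+1) (v w : 'cV[R]_n.+1) :
  v != 0 -> iR A *m v = t *: v -> w != 0 -> iR A *m w = t *: w ->
  exists a b, [/\ a != 0, b != 0 & a *: v = b *: w].
Proof.
move=> v0 Av w0 Aw.
have entry0 (u : 'cV[R]_n.+1) : u != 0 -> iR A *m u = t *: u -> u 0 0 != 0.
  move=> u0 Au; apply/eqP => u00; have := eigen_Zfree u0 Au (c := delta_mx 0 0).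
  rewrite map_delta_mx -rowE [row _ _]mx11_scalar mxE u00 raddf0.
  by move=> /(_ erefl)/rowP/(_ 0)/eqP; rewrite !mxE eqxx oner_eq0.
exists (w 0 0), (v 0 0); split; try exact: entry0.
apply/eqP; rewrite -subr_eq0; set u := _ - _.
have Au : iR A *m u = t *: u.
  by rewrite mulmxBr -!scalemxAr Av Aw scalerBr !scalerA !(mulrC t).
apply/negPn/negP => u0; have /eqP := entry0 u u0 Au; apply.
by rewrite !mxE mulrC subrr.
Qed.

Definition powers_col : 'cV[R]_n.+1 := \col_i t ^+ i.

Lemma mul_powers_col (c : 'rV[int]_n.+1) :
  iR c *m powers_col = (ev (rVpoly c))%:M.
Proof.
rewrite [LHS]mx11_scalar; congr (_%:M).
rewrite (horner_coef_wide _ (_ : _ <= n.+1)%N); last first.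
  exact: leq_trans (size_poly _ _) (size_poly _ _).
rewrite mxE; apply: eq_bigr => i _.
by rewrite !mxE coef_map /= coef_rVpoly_ord.
Qed.

(** For a row vector e, the matrix K with rows e, e A, ..., e A^n conjugates A
    to the companion matrix of f, which has the eigenvector (1, t, ..., t^n).
    As K is invertible only over the rationals, the eigenvector of A is
    obtained with the adjugate of K. *)
Lemma eigenvector_exists (A : 'M[int]_n.+1) :
  horner_mx A f = 0 -> exists2 v : 'cV[R]_n.+1, v != 0 & iR A *m v = t *: v.
Proof.
move=> fA0; pose e : 'rV[int]_n.+1 := delta_mx 0 0.
have e0 : e != 0.
  by apply/eqP => /rowP/(_ 0)/eqP; rewrite !mxE eqxx oner_eq0.
pose K := krylov A e n.+1.
have detK : \det K != 0.
  apply/det0P => -[y y0 yK]; case/eqP: y0.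
  apply: krylov_free f_irr _ e0 _ yK; first by rewrite fA0 mulmx0.
  by rewrite size_f.
pose v : 'cV[R]_n.+1 := iR (\adj K) *m powers_col.
have Kv : iR K *m v = (\det K)%:~R *: powers_col.
  by rewrite mulmxA -map_mxM mul_mx_adj map_scalar_mx mul_scalar_mx.
have ev_v p : iR (e *m horner_mx A p) *m v = ((\det K)%:~R * ev p)%:M.
  have -> : horner_mx A p = horner_mx A (p %% f).
    rewrite [in LHS](Pdiv.IdomainMonic.divp_eq f_monic p) rmorphD rmorphM /=.
    by rewrite fA0 mulr0 add0r.
  rewrite -(poly_rV_K (size_modp_f p)) -mulmx_krylov map_mxM -mulmxA Kv.
  rewrite -scalemxAr mul_powers_col poly_rV_K ?size_modp_f // ev_modp.
  by rewrite scale_scalar_mx.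
have dK0 : (\det K)%:~R != 0 :> R.
  by apply: contra detK => /eqP dK; apply/eqP/int_inj; rewrite dK rmorph0.
exists v.
  apply/eqP => v0; have := ev_v 1; rewrite v0 mulmx0 rmorph1 hornerC mulr1.
  move=> /esym/(congr1 (fun M : 'M_1 => M 0 0)); rewrite !mxE mulr1n => /eqP.
  by rewrite (negPf dK0).
(* K can be cancelled on the left, because its determinant is nonzero in R. *)
suff KAv : iR K *m (iR A *m v) = iR K *m (t *: v).
  have /(congr1 (mulmx (iR (\adj K)))) := KAv; rewrite mulmxA -map_mxM mul_adj_mx.
  rewrite [in RHS]mulmxA -map_mxM mul_adj_mx map_scalar_mx !mul_scalar_mx => E.
  apply/colP => i; apply: (mulfI dK0); have /colP/(_ i) := E.
  by rewrite !mxE.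
rewrite mulmxA -map_mxM -scalemxAr; apply/row_matrixP => i.
have rowKi : row i K = e *m horner_mx A 'X^i by rewrite rowK.
rewrite linearZ /= !row_mul -!map_row row_mul rowKi -mulmxA.
rewrite -{2}(horner_mx_X A) mulmxE -rmorphM -exprSr !ev_v.
by rewrite !map_polyXn !hornerXn scale_scalar_mx exprS mulrCA.
Qed.

(** In the basis of powers of t, the ideal is a lattice; it has full rank because
    it contains the multiples of a nonzero integer, by [int_multiple]. *)
Lemma ideal_Zbasis (S : set R) :
  is_nonzero_ideal S -> exists v : 'cV[R]_n.+1, is_Zbasis S v.
Proof.
case=> S0 SD SM [x Sx x0]; have [y [N [N0 yx]]] := int_multiple x0.
pose L (c : 'rV[int]_n.+1) := S (ev (rVpoly c)).
have [||B detB LB] := @full_lattice_basis _ L N _ N0.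
- move=> a b La Lb; rewrite /L linearB rmorphB hornerD hornerN -mulN1r.
  by apply: SD => //; apply: SM.
- move=> c; rewrite /L linearZ /= map_polyZ hornerZ /= -yx mulrAC.
  exact: SM.
exists (iR B *m powers_col); apply/is_ZbasisE; split; last first.
  move=> c; rewrite mulmxA -map_mxM mul_powers_col => E.
  have /ev_rVpoly_eq0 cB : ev (rVpoly (c *m B)) = 0.
    by have /(congr1 (fun M : 'M_1 => M 0 0)) := E; rewrite !mxE mulr1n.
  by apply: contraNeq detB => c0; apply/det0P; exists c.
apply/seteqP; split=> z.
  have [c ->] := ev_rVpoly z => /LB[w ->]; apply/ZspanE; exists w.
  by rewrite mulmxA -map_mxM mul_powers_col.
move/ZspanE => [c]; rewrite mulmxA -map_mxM mul_powers_col => E.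
have -> : z = ev (rVpoly (c *m B)).
  by have /(congr1 (fun M : 'M_1 => M 0 0)) := E; rewrite !mxE !mulr1n.
by apply/LB; exists c.
Qed.

Lemma Zbasis_matrix (S : nonzero_ideal R) (v : 'cV[R]_n.+1) :
  is_Zbasis S v -> exists A : 'M[int]_n.+1, t *: v = iR A *m v.
Proof.
move=> /is_ZbasisE[SE free_v]; apply: Zspan_sub_mx => i; rewrite -SE mxE.
by apply: idealM (nonzero_idealP S) _ _ _; rewrite SE; apply: Zspan_entry.
Qed.

(** Multiplication by t has matrix A on v and B on w, so P carries one matrix to
    the other. *)
Lemma Zfree_eigen_conj (A B P : 'M[int]_n.+1) (v w : 'cV[R]_n.+1) :
  P \in unitmx -> Zfree w -> v = iR P *m w ->
  iR A *m v = t *: v -> iR B *m w = t *: w -> A = P *m B *m invmx P.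
Proof.
move=> uP free_w Dv Av Bw; apply: conj_unitmx => //.
apply: (Zfree_mx_inj free_w); rewrite !map_mxM -!mulmxA -Dv Av Bw.
by rewrite -scalemxAr Dv.
Qed.

End LatimerMacDuffee.

(** * Roots of the reciprocal polynomial *)

Lemma horner_mx_intertwine (R : comNzRingType) (n : nat) (A B P : 'M[R]_n.+1)
    (p : {poly R}) :
  A *m P = P *m B -> horner_mx A p *m P = P *m horner_mx B p.
Proof.
move=> AP; elim/poly_ind: p => [|p c IHp].
  by rewrite !rmorph0 mul0mx mulmx0.
rewrite !rmorphD !rmorphM /= !horner_mx_X !horner_mx_C mulmxDl mulmxDr.
by rewrite scalar_mxC -!mulmxE -mulmxA AP mulmxA IHp mulmxA.
Qed.

Lemma horner_mx_conj_eq0 (R : comUnitRingType) (n : nat) (A B P : 'M[R]_n.+1)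
    (p : {poly R}) :
  P \in unitmx -> A = P *m B *m invmx P -> horner_mx B p = 0 ->
  horner_mx A p = 0.
Proof.
move=> uP DA pB; have AP : A *m P = P *m B by rewrite DA mulmxKV.
by rewrite -[LHS](mulmxK uP) (horner_mx_intertwine _ AP) pB mulmx0 mul0mx.
Qed.

(** The relation p(A) = 0 reads q(A) A = - p(0), where p = q X + p(0). *)
Lemma unitmx_horner_eq0 (R : comUnitRingType) (n : nat) (A : 'M[R]_n.+1)
    (p : {poly R}) :
  p`_0 \is a GRing.unit -> horner_mx A p = 0 -> A \in unitmx.
Proof.
move=> up pA.
have [q Dp] : exists q, p = q * 'X + (p`_0)%:P.
  by exists (Poly (behead p)); apply/polyP => -[|i];
    rewrite coefD coefMX coefC /= ?add0r // addr0 coef_Poly nth_behead.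
move: pA; rewrite Dp rmorphD rmorphM /= horner_mx_X horner_mx_C => /eqP.
rewrite addr_eq0 => /eqP qA.
suff /mulmx1_unit[] : (- (p`_0)^-1) *: horner_mx A q *m A = 1%:M by [].
by rewrite -scalemxAl mulmxE qA scaleNr scalerN opprK scale_scalar_mx mulVr.
Qed.

Section StarPoly.
Variables (n : nat) (f : {poly int}).

Lemma coef_starpoly i :
  (starpoly n f)`_i = if (i <= n)%N then (-1) ^+ n * f`_(n - i) else 0.
Proof.
rewrite coef_sum; under eq_bigr do rewrite coefZ coefXn.
case: leqP => [le_in|lt_ni].
  rewrite (bigD1 (Ordinal (leq_subr i n : n - i < n.+1)%N)) //= subKn // eqxx.
  rewrite mulr1 big1 ?addr0 // => j nj; case: eqP => [Ei|]; last by rewrite mulr0.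
  case/eqP: nj; apply: val_inj; rewrite /= Ei subKn //.
  by rewrite -ltnS.
rewrite big1 // => j _; case: eqP => [Ei|]; last by rewrite mulr0.
by move: lt_ni; rewrite Ei ltnNge leq_subr.
Qed.

Lemma horner1_starpoly :
  (size f <= n.+1)%N -> (starpoly n f).[1] = (-1) ^+ n * f.[1].
Proof.
move=> sf; rewrite horner_sum (horner_coef_wide _ sf) mulr_sumr.
by apply: eq_bigr => i _; rewrite hornerZ hornerXn !expr1n !mulr1.
Qed.

End StarPoly.

Lemma horner_mx_starpoly (n : nat) (f : {poly int}) (A : 'M[int]_n.+1) :
  (size f <= n.+2)%N -> A \in unitmx ->
  horner_mx A (starpoly n.+1 f) =
    (-1) ^+ n.+1 *: (A ^+ n.+1 *m horner_mx (invmx A) f).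
Proof.
move=> sf uA; have uA' : A \is a GRing.unit by [].
rewrite -[in RHS](coefK f) poly_def.
rewrite (big_ord_widen n.+2 (fun i => f`_i *: 'X^i)) //.
rewrite /starpoly !rmorph_sum /= mulmx_sumr scaler_sumr [RHS]big_mkcond /=.
apply: eq_bigr => i _; case: ifP => [_|/negbT]; last first.
  by rewrite -leqNgt => /(nth_default 0) ->; rewrite mulr0 scale0r rmorph0.
rewrite !linearZ /= !rmorphXn /= !horner_mx_X.
rewrite scalerA mulrC; congr (_ *: _); rewrite -[invmx A]/(A^-1) exprVn mulmxE.
have le_i : (i <= n.+1)%N by rewrite -ltnS.
have -> : A ^+ n.+1 = A ^+ (n.+1 - i) * A ^+ i by rewrite -exprD subnK.
by rewrite mulrK // unitrX.
Qed.

Section SelfReciprocal.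
Variables (n : nat) (f : {poly int}).
Hypothesis cs_f : cappell_shaneson_poly n.+1 f.

Lemma cs_poly_monic : f \is monic.
Proof. by have [A _ ->] := cs_f; rewrite char_poly_monic. Qed.

Lemma cs_poly_size : size f = n.+2.
Proof. by have [A _ ->] := cs_f; rewrite size_char_poly. Qed.

Lemma cs_poly_coef0 : f`_0 = (-1) ^+ n.+1.
Proof. by have [A csA ->] := cs_f; rewrite cs_char_poly_coef0. Qed.

Lemma cs_poly_coefN : f`_n.+1 = 1.
Proof. by have /monicP := cs_poly_monic; rewrite lead_coefE cs_poly_size. Qed.

Lemma cs_root_unitmx (A : 'M[int]_n.+1) : horner_mx A f = 0 -> A \in unitmx.
Proof.
by apply: unitmx_horner_eq0; rewrite cs_poly_coef0 unitrX // unitrN1.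
Qed.

Lemma cs_star_root_unitmx (A : 'M[int]_n.+1) :
  horner_mx A (starpoly n.+1 f) = 0 -> A \in unitmx.
Proof.
apply: unitmx_horner_eq0; rewrite coef_starpoly subn0 cs_poly_coefN mulr1.
by rewrite unitrX // unitrN1.
Qed.

Lemma cs_star_rootE (A : 'M[int]_n.+1) :
  A \in unitmx ->
  (horner_mx A (starpoly n.+1 f) == 0) = (horner_mx (invmx A) f == 0).
Proof.
move=> uA; rewrite horner_mx_starpoly ?cs_poly_size //.
have uAn : A ^+ n.+1 \is a GRing.unit by rewrite unitrX.
apply/eqP/eqP => [|->]; last by rewrite mulmx0 scaler0.
move/(congr1 (fun M => (-1) ^+ n.+1 *: M)); rewrite scaler0 scalerA -expr2.
rewrite sqrr_sign scale1r => /(congr1 (mulmx (invmx (A ^+ n.+1)))).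
by rewrite mulmx0 mulKmx.
Qed.

Lemma cs_no_int_root (m : int) : (1 < n.+1)%N -> ~~ root f m.
Proof.
move=> n_gt; apply/negP => fm; have [_ irr] := cs_irreducible cs_f.
have : 'X - m%:P %| f by rewrite dvdp_XsubCl.
move/irr; rewrite size_XsubC => /(_ isT)/eqp_size.
by rewrite size_XsubC cs_poly_size => -[n0]; move: n_gt; rewrite -n0.
Qed.

(** Both polynomials are monic of degree n.+1, so their difference has smaller
    degree; being coprime to f and zero at A, it would give a nonzero constant
    that vanishes at A. *)
Lemma cs_self_reciprocal (A : 'M[int]_n.+1) :
  horner_mx A f = 0 -> horner_mx A (starpoly n.+1 f) = 0 ->
  starpoly n.+1 f = f.
Proof.
move=> fA sA; apply/eqP; rewrite -subr_eq0; apply/negPn/negP => d0.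
have lt_d : (size (starpoly n.+1 f - f)%R < size f)%N.
  rewrite cs_poly_size ltnS; apply/leq_sizeP => i; rewrite leq_eqVlt coefB.
  case/predU1P => [<-|lt_ni].
    rewrite coef_starpoly leqnn subnn cs_poly_coef0 cs_poly_coefN -expr2.
    by rewrite sqrr_sign subrr.
  rewrite coef_starpoly leqNgt lt_ni sub0r nth_default ?oppr0 //.
  by rewrite cs_poly_size.
have [u [w [c [c0 /(congr1 (horner_mx A))]]]] :=
  irredp_Bezout_small (cs_irreducible cs_f) d0 lt_d.
rewrite rmorphD !rmorphM rmorphB /= fA sA subr0 !mulr0 addr0 horner_mx_C.
by move=> /matrixP/(_ 0 0)/eqP; rewrite !mxE eqxx mulr1n eq_sym (negPf c0).
Qed.

Lemma cs_self_reciprocal_even : (1 < n.+1)%N ->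
  starpoly n.+1 f = f -> ~~ odd n.+1.
Proof.
move=> n_gt sf; apply/negP => n_odd; have /negP := cs_no_int_root 1 n_gt; apply.
have := horner1_starpoly (eq_leq cs_poly_size); rewrite sf -signr_odd n_odd.
by rewrite expr1 mulN1r => /esym/eqP; rewrite eqNr.
Qed.

(** The roots of a reciprocal polynomial come in pairs a, 1/a, and the two
    are different, since 1 and -1 are not roots. The corresponding eigenvectors
    span an invariant plane of determinant 1, which the condition for k = 2
    forbids. *)
Lemma cs_self_reciprocal_lt4 : (1 < n.+1)%N ->
  starpoly n.+1 f = f -> (n.+1 < 4)%N.
Proof.
move=> n_gt sf; rewrite ltnNge; apply/negP => n_ge4.
have [A csA Df] := cs_f.
pose F := map_poly (intr : int -> algC) f.
have sF : size F = size f.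
  by rewrite size_map_poly_id0 // (monicP cs_poly_monic) rmorph1 oner_eq0.
have [a Fa] : exists a, root F a by apply/closed_rootP; rewrite sF cs_poly_size.
have nroot (m : int) : a != m%:~R.
  apply: contraNneq (cs_no_int_root m n_gt) => am; move: Fa.
  by rewrite am /root horner_map /= intr_eq0.
have a0 : a != 0 by have := nroot 0.
have aV : a^-1 != a.
  rewrite eq_sym -subr_eq0; apply/eqP => /(congr1 ( *%R a)).
  rewrite mulrBr divff // mulr0 -expr2 => /eqP; rewrite subr_eq0 sqrf_eq1.
  by rewrite (negPf (nroot 1)) (negPf (nroot (-1))).
have FaV : root F a^-1.
  have := starpolyE (eq_leq cs_poly_size) a0; rewrite sf -/F (rootP Fa).
  by move/esym/eqP; rewrite mulf_eq0 expf_eq0 /= oppr_eq0 (negPf a0).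
pose AC := map_mx (intr : int -> algC) A.
have FE : F = char_poly AC by rewrite /F Df map_char_poly.
have /eigenvalueP[v vA v0] : eigenvalue AC a by rewrite eigenvalue_root_char -FE.
have /eigenvalueP[w wA w0] : eigenvalue AC a^-1.
  by rewrite eigenvalue_root_char -FE.
pose W := col_mx v w : 'M_(1 + 1, n.+1).
pose B := block_mx (a%:M : 'M_1) 0 0 (a^-1%:M : 'M_1).
have WA : W *m AC = B *m W.
  rewrite mul_col_mx vA wA mul_block_col !mul0mx addr0 add0r.
  by rewrite !mul_scalar_mx.
have detB : \det B = 1 by rewrite det_ublock !det_scalar1 divff.
have freeW : row_free W.
  apply: inj_row_free => c; rewrite -[c : 'rV_(1 + 1)]hsubmxK mul_row_col.
  rewrite [lsubmx _]mx11_scalar [rsubmx _]mx11_scalar !mul_scalar_mx.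
  set x := lsubmx _ 0 0; set y := rsubmx _ 0 0 => xy0.
  have : (y * (a^-1 - a)) *: w = 0.
    have -> : (y * (a^-1 - a)) *: w =
        x *: (a *: v) + y *: (a^-1 *: w) - a *: (x *: v + y *: w).
      by apply/rowP => i; rewrite !mxE; ring.
    by rewrite -vA -wA !scalemxAl -mulmxDl xy0 mul0mx scaler0 subr0.
  move/eqP; rewrite scaler_eq0 (negPf w0) orbF mulf_eq0 subr_eq0 (negPf aV) orbF.
  move/eqP => y0; have /eqP := xy0; rewrite y0 scale0r addr0 scaler_eq0.
  by rewrite (negPf v0) orbF => /eqP ->; rewrite raddf0 row_mx0.
have k_range : (1 <= 2 <= n.+1./2)%N by rewrite (half_leq n_ge4).
have /negP := cs_det_invariant_neq1 csA k_range freeW WA; apply.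
exact/eqP.
Qed.

End SelfReciprocal.

(** * The quadratic case *)

(** A prime p dividing f(1) would make 1 an eigenvalue of A modulo p, which the
    condition for k = 1, read modulo p, forbids. *)
Lemma cs_char_poly1 (n : nat) (f : {poly int}) :
  cappell_shaneson_poly n f -> (1 < n)%N -> `|f.[1]|%N = 1%N.
Proof.
case=> A csA -> n_gt; apply/eqP/negPn/negP => f1.
have [p p_pr pf] : exists2 p, prime p & (p %| `|(char_poly A).[1]|)%N.
  have [->|f1_gt] := posnP `|(char_poly A).[1]|%N; first by exists 2%N.
  exists (pdiv `|(char_poly A).[1]|); last exact: pdiv_dvd.
  by apply: pdiv_prime; rewrite ltn_neqAle eq_sym f1.
have /eigenvalueP[v vA v0] : eigenvalue (map_mx (intr : int -> 'F_p) A) 1.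
  rewrite eigenvalue_root_char -map_char_poly /root.
  rewrite -(rmorph1 (intr : int -> 'F_p)) horner_map /=.
  have dvd_p := dvdn_pcharf (pchar_Fp p_pr).
  have intr0 m : (p %| `|m|)%N -> m%:~R = 0 :> 'F_p.
    case: m => m; rewrite ?NegzE ?rmorphN /= => pm.
      by apply/eqP; rewrite -[_%:~R]pmulrn -dvd_p.
    by apply/eqP; rewrite oppr_eq0 -[_%:~R]pmulrn -dvd_p.
  exact/eqP/intr0.
have freev : row_free v by rewrite -row_leq_rank lt0n mxrank_eq0.
have vA1 : v *m map_mx intr A = 1%:M *m v by rewrite vA scale1r mul1mx.
have k_range : (1 <= 1 <= n./2)%N by rewrite half_gt0.
by have := cs_det_invariant_neq1 csA k_range freev vA1; rewrite det1 eqxx.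
Qed.

(** Gauss reduction. A substitution x + s y makes the absolute value of the middle
    coefficient at most that of p; if the last coefficient is then smaller than
    p, exchange the variables and repeat. A reduced form has p^2 at most 1,
    because its discriminant is -3 or 5, and p is not 0, because neither -3 nor
    5 is a square. *)
Lemma quadratic_form_unit_value (p q r : int) :
  q ^+ 2 - 4 * p * r = -3 \/ q ^+ 2 - 4 * p * r = 5 ->
  exists x y : int, `|(p * x ^+ 2 + q * x * y + r * y ^+ 2)%R|%N = 1%N.
Proof.
have [k le_pk] : exists k, (`|p| <= k)%N by exists `|p|%N.
elim: k => [|k IHk] in p q r le_pk *.
  move=> disc; exfalso; have p0 : p = 0 by lia.
  rewrite p0 in disc.
  have : (-2 <= q <= 2) \/ 9 <= q * q by nia.
  by rewrite expr2 in disc; case=> [?|?]; nia.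
move=> disc.
have p0 : p != 0.
  apply/eqP => p0; rewrite p0 expr2 in disc.
  have : (-2 <= q <= 2) \/ 9 <= q * q by nia.
  by case=> [?|?]; nia.
(* s is minus the integer nearest to q / (2 p). *)
have [s le_s] : exists s, (`|(q + 2 * p * s)%R| <= `|p|)%N.
  exists (- ((q + `|p|) %/ (2 * p))%Z).
  have := divz_eq (q + `|p|) (2 * p).
  have p2 : 2 * p != 0 by lia.
  have := modz_ge0 (q + `|p|) p2; have := ltz_mod (q + `|p|) p2.
  move: (_ %% _)%Z (_ %/ _)%Z => b a b_lt b_ge E.
  rewrite mulrN mulrC; move: (a * (2 * p)) E => c E; lia.
pose q' := q + 2 * p * s; pose r' := p * s ^+ 2 + q * s + r.
have disc' : q' ^+ 2 - 4 * p * r' = q ^+ 2 - 4 * p * r by rewrite /q' /r'; ring.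
have [lt_r|le_r] := ltnP `|r'| `|p|.
  have [||x [y E]] := IHk r' q' p; first by lia.
    by rewrite mulrAC disc'.
  exists (y + s * x), x; apply: etrans E; congr (absz _); rewrite /q' /r'; ring.
exists 1, 0; rewrite expr1n expr0n !mulr0 !addr0 mulr1.
suff : p * p <= 1 by clear -p0; nia.
have : (`|p| * `|p| <= `|p| * `|r'|)%N by exact: leq_mul.
have : (`|q'| * `|q'| <= `|p| * `|p|)%N by apply: leq_mul.
rewrite -!abszM; have := sqr_ge0 p; have := sqr_ge0 q'.
rewrite -disc' -mulrA !expr2 in disc *.
move: (p * p) (q' * q') (p * r') disc => P Q T disc Q0 P0 QP PT.
by lia.
Qed.

Lemma det_mx2 (R : comNzRingType) (M : 'M[R]_2) :
  \det M = M 0 0 * M 1 1 - M 0 1 * M 1 0.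
Proof.
rewrite (expand_det_row _ 0) !big_ord_recl big_ord0 /cofactor !det_mx11 !mxE /=.
rewrite addr0 expr0 expr1 mul1r mulN1r mulrN.
by congr (_ * M _ _ - M _ _ * M _ _); apply: val_inj.
Qed.

(** The matrix with columns v and A v carries the companion matrix of f to A. Its
    determinant is a binary quadratic form in the entries of v, whose
    discriminant is that of f, namely -3 or 5; so some v makes it a unit. *)
Lemma cs2_conj_companion (f : {poly int}) (A : 'M[int]_2) :
  cappell_shaneson_poly 2 f -> horner_mx A f = 0 ->
  exists2 P : 'M[int]_2, P \in unitmx &
    A = P *m block_mx (0 : 'M_1) (-1)%:M 1%:M (- f`_1)%:M *m invmx P.
Proof.
move=> cs_f; have sf := cs_poly_size cs_f.
have f0 : f`_0 = 1 by rewrite (cs_poly_coef0 cs_f) sqrrN expr1n.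
have f2 : f`_2 = 1 := cs_poly_coefN cs_f.
have f1 := cs_char_poly1 cs_f isT.
pose b := f`_1.
have Df : f = 1%:P + b *: 'X + 'X ^+ 2.
  rewrite -[LHS]coefK poly_def sf !big_ord_recl big_ord0 /= f0 f2 -/b.
  by rewrite addr0 !scale1r addrA expr0 polyC1.
have Db : b = -1 \/ b = -3 by move: f1; rewrite Df !hornerE /=; lia.
rewrite {1}Df !rmorphD /= linearZ /= rmorphXn /= horner_mx_X horner_mx_C => A2.
have entry i j : (i == j)%:R + b * A i j + (A i 0 * A 0 j + A i 1 * A 1 j) = 0.
  have /matrixP/(_ i j) := A2.
  rewrite !mxE !big_ord_recl big_ord0 addr0.
  by rewrite (_ : lift 0 0 = 1) //; exact: val_inj.
have e00 := entry 0 0; have e01 := entry 0 1.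
rewrite /= in e00 e01.
have no_root (a : int) : 1 + b * a + a * a != 0.
  have H : a <= 0 \/ a = 1 \/ a = 2 \/ 3 <= a by lia.
  by apply/eqP; case: Db => -> E; case: H E => [|[->|[->|]]]; nia.
(* At the position (0, 1), A^2 + b A + 1 = 0 says that tr A + b kills A 0 1; and
   if A 0 1 is 0, then A 0 0 is an integral root of f. *)
have tr : A 0 0 + A 1 1 = - b.
  have [a12|a12] := eqVneq (A 0 1) 0.
    case/negP: (no_root (A 0 0)); rewrite -[X in _ == X]e00 a12.
    by rewrite mul0r addr0.
  apply: (mulfI a12); apply/eqP; rewrite -subr_eq0 -[X in _ == X]e01.
  by apply/eqP; ring.
have det1 : A 0 0 * A 1 1 - A 0 1 * A 1 0 = 1.
  have -> : A 1 1 = - b - A 0 0 by rewrite -tr addrC addKr.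
  have -> : A 0 1 * A 1 0 = - 1 - b * A 0 0 - A 0 0 * A 0 0.
    by apply/eqP; rewrite -subr_eq0 -[X in _ == X]e00; apply/eqP; ring.
  ring.
have [x [y xy]] : exists x y : int,
    `|(A 1 0 * x ^+ 2 + (A 1 1 - A 0 0) * x * y + (- A 0 1) * y ^+ 2)%R|%N = 1%N.
  apply: quadratic_form_unit_value.
  have -> : (A 1 1 - A 0 0) ^+ 2 - 4 * A 1 0 * - A 0 1 =
      (A 0 0 + A 1 1) ^+ 2 - 4 * (A 0 0 * A 1 1 - A 0 1 * A 1 0) by ring.
  by rewrite tr det1; case: Db => ->; [left|right].
pose v : 'cV[int]_2 := \col_i (if i == 0 then x else y).
pose P := row_mx v (A *m v) : 'M_(2, 1 + 1).
have v0 : v 0 0 = x by rewrite mxE.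
have v1 : v 1 0 = y by rewrite mxE.
have Pl i : P i 0 = v i 0.
  by rewrite -[RHS](row_mxEl v (A *m v)); congr (P i _); apply: val_inj.
have Pr i : P i 1 = A i 0 * x + A i 1 * y.
  have -> : P i 1 = (A *m v) i 0.
    by rewrite -[RHS](row_mxEr v (A *m v)); congr (P i _); apply: val_inj.
  rewrite mxE !big_ord_recl big_ord0 addr0 (_ : lift 0 0 = 1) ?v0 ?v1 //.
  exact: val_inj.
have uP : (P : 'M_2) \in unitmx.
  rewrite unitmxE det_mx2 !Pl !Pr v0 v1.
  rewrite (_ : _ - _ = A 1 0 * x ^+ 2 + (A 1 1 - A 0 0) * x * y +
    (- A 0 1) * y ^+ 2); last by ring.
  by move: (_ + _) xy => d; case: d => [[|[]]|[]].
have AP : A *m row_mx v (A *m v) =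
    row_mx v (A *m v) *m block_mx (0 : 'M_1) (-1)%:M 1%:M (- b)%:M.
  rewrite mul_mx_row mul_row_block mulmx0 add0r mulmx1 !mul_mx_scalar scaleN1r.
  congr row_mx; apply/eqP; rewrite -subr_eq0 -[X in _ == X](mul0mx _ v) -A2.
  rewrite !mulmxDl mul1mx -scalemxAl (_ : A ^+ 2 = A *m A) // -mulmxA.
  by rewrite scaleNr opprD !opprK addrC.
by exists P => //; apply: conj_unitmx.
Qed.

(** * Conjugacy of star-equivalent roots *)

(** If A is conjugate to the inverse of B, then A is a root of both f and its
    reciprocal, so f is self-reciprocal, which leaves only degrees 1 and 2. In
    degree 1, f has a single matrix root; in degree 2, all matrix roots of f are
    conjugate to the companion matrix. *)
Lemma star_equiv_conj (n : nat) (f : {poly int}) (A B : 'M[int]_n.+1) :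
  cappell_shaneson_poly n.+1 f -> horner_mx A f = 0 -> horner_mx B f = 0 ->
  star_equiv A B ->
  exists2 P : 'M[int]_n.+1, P \in unitmx & A = P *m B *m invmx P.
Proof.
move=> cs_f fA fB [P uP [DA|DA]]; first by exists P.
have uB := cs_root_unitmx cs_f fB.
have f_star : starpoly n.+1 f = f.
  apply: (cs_self_reciprocal cs_f fA); apply: (horner_mx_conj_eq0 uP DA).
  apply/eqP; rewrite (cs_star_rootE cs_f) ?unitmx_inv // invmxK.
  exact/eqP.
case: n => [|n] in f A B cs_f fA fB P uP DA uB f_star *.
  exists 1%:M; rewrite ?unitmx1 // invmx1 mulmx1 mul1mx.
  have Df : f = 'X + (f`_0)%:P.
    apply/polyP => -[|[|i]]; rewrite coefD coefX coefC ?add0r //=.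
      by rewrite addr0 (cs_poly_coefN cs_f).
    by rewrite nth_default ?addr0 // (cs_poly_size cs_f).
  have scalar M : horner_mx M f = 0 -> M = (- f`_0)%:M :> 'M_1.
    rewrite {1}Df rmorphD /= horner_mx_X horner_mx_C => /eqP.
    by rewrite addr_eq0 raddfN => /eqP.
  exact: etrans (scalar A fA) (esym (scalar B fB)).
case: n => [|n] in f A B cs_f fA fB P uP DA uB f_star *.
  have [Q uQ ->] := cs2_conj_companion cs_f fA.
  have [S uS DB] := cs2_conj_companion cs_f fB.
  set K := block_mx _ _ _ _ in DB *.
  have DK : K = invmx S *m B *m S.
    by rewrite DB -!mulmxA mulVmx // mulmx1 mulKmx.
  exists (Q *m invmx S); first by rewrite unitmx_mul uQ unitmx_inv.
  apply: conj_unitmx; first by rewrite unitmx_mul uQ unitmx_inv.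
  by rewrite DK -!mulmxA mulKmx // mulmxV // mulmx1.
have n_even := cs_self_reciprocal_even cs_f isT f_star.
have n_small := cs_self_reciprocal_lt4 cs_f isT f_star.
by exfalso; clear -n_even n_small; case: n n_even n_small => [|[|n]].
Qed.

(** * The correspondence of classes *)

Section ZadjoinFacts.
Variables (C : numClosedFieldType) (theta : C).
Local Notation R := (Zadjoin theta).
Local Notation t := (Zadjoin_gen theta).

Lemma val_horner_Zadjoin (p : {poly int}) :
  val (map_poly (intr : int -> R) p).[t] = (map_poly intr p).[theta].
Proof.
rewrite -horner_map -map_poly_comp /=; congr _.[_]; apply: eq_map_poly => m.
exact: (rmorph_int (val : R -> C)).
Qed.

Lemma Zadjoin_genP (x : R) :
  exists p : {poly int}, x = (map_poly intr p).[t].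
Proof.
have /asboolP[p xp] := Zadjoin_valP x; exists p; apply: val_inj.
by rewrite val_horner_Zadjoin.
Qed.

Lemma Zadjoin_int_inj : injective (intr : int -> R).
Proof.
have val_int m : val (m%:~R : R) = m%:~R := rmorph_int (val : R -> C) m.
by move=> a b /(congr1 val); rewrite !val_int => /intr_inj.
Qed.

Lemma Zadjoin_root (f : {poly int}) :
  root (map_poly intr f) theta -> root (map_poly intr f) t.
Proof.
move=> /rootP ft; apply/rootP/val_inj.
by rewrite val_horner_Zadjoin ft rmorph0.
Qed.

End ZadjoinFacts.

Lemma star_classP (n : nat) (f : {poly int}) (A B : X_set n f) :
  star_class A = star_class B <-> star_equiv (\val A) (\val B).
Proof.
split=> [/eqquotP/asboolP//|AB]; apply/eqquotP/asboolP; exact: AB.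
Qed.

Lemma ideal_classP (R : idomainType) (I J : nonzero_ideal R) :
  ideal_class I = ideal_class J <-> ideal_equiv I J.
Proof.
split=> [/eqquotP/asboolP//|AB]; apply/eqquotP/asboolP; exact: AB.
Qed.

Lemma Zspan_classP (R : idomainType) (m : nat) (v w : 'cV[R]_m)
    (I J : nonzero_ideal R) (a b : R) :
  ideal_set I = Zspan v -> ideal_set J = Zspan w -> a != 0 -> b != 0 ->
  Zspan (a *: v) = Zspan (b *: w) -> ideal_class I = ideal_class J.
Proof.
move=> DI DJ a0 b0 vw; apply/ideal_classP; exists a, b; split=> //.
by rewrite DI DJ -!Zspan_scale.
Qed.

Theorem theorem3p8 (n : nat) (f : {poly int}) (C : numClosedFieldType)
    (theta : C)
    (hf : cappell_shaneson_poly n.+1 f)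
    (htheta : root (map_poly intr f) theta) :
  (* X_f is contained in GL(n; Z), where the *-equivalence is defined *)
  (forall A : X_set n f, \val A \in unitmx) /\
  (* the choices made in (1) are possible, and S is a non-zero ideal *)
  (forall c : X_star n f,
     exists2 A : X_set n f, star_class A = c & horner_mx (\val A) f = 0) /\
  (forall A : X_set n f, horner_mx (\val A) f = 0 ->
     exists2 v : 'cV[Zadjoin theta]_n.+1,
       v != 0 & map_mx intr (\val A) *m v = Zadjoin_gen theta *: v) /\
  (forall (A : X_set n f) (v : 'cV[Zadjoin theta]_n.+1),
     horner_mx (\val A) f = 0 ->
     v != 0 -> map_mx intr (\val A) *m v = Zadjoin_gen theta *: v ->
     is_nonzero_ideal (Zspan v)) /\
  (* the choices made in (2) are possible, and A belongs to X_f *)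
  (forall S : nonzero_ideal (Zadjoin theta),
     exists v : 'cV[Zadjoin theta]_n.+1, is_Zbasis S v) /\
  (forall (S : nonzero_ideal (Zadjoin theta)) (v : 'cV[Zadjoin theta]_n.+1),
     is_Zbasis S v ->
     exists! A : 'M[int]_n.+1, Zadjoin_gen theta *: v = map_mx intr A *m v) /\
  (forall (S : nonzero_ideal (Zadjoin theta)) (v : 'cV[Zadjoin theta]_n.+1)
     (A : 'M[int]_n.+1),
     is_Zbasis S v -> Zadjoin_gen theta *: v = map_mx intr A *m v ->
     in_X f A) /\
  (* the resulting maps do not depend on the choices and are inverse to each
     other *)
  exists (phi : X_star n f -> ideal_class_monoid (Zadjoin theta))
         (psi : ideal_class_monoid (Zadjoin theta) -> X_star n f),
    (forall (A : X_set n f) (v : 'cV[Zadjoin theta]_n.+1)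
       (S : nonzero_ideal (Zadjoin theta)),
       horner_mx (\val A) f = 0 ->
       v != 0 -> map_mx intr (\val A) *m v = Zadjoin_gen theta *: v ->
       ideal_set S = Zspan v ->
       phi (star_class A) = ideal_class S) /\
    (forall (S : nonzero_ideal (Zadjoin theta))
       (v : 'cV[Zadjoin theta]_n.+1) (A : X_set n f),
       is_Zbasis S v ->
       Zadjoin_gen theta *: v = map_mx intr (\val A) *m v ->
       psi (ideal_class S) = star_class A) /\
    bijective phi /\ bijective psi /\ cancel phi psi /\ cancel psi phi.
Proof.
pose R := Zadjoin theta; pose t : R := Zadjoin_gen theta.
have f_monic := cs_poly_monic hf; have f_size := cs_poly_size hf.
have f_irr := cs_irreducible hf.
have t_inj := @Zadjoin_int_inj C theta; have t_gen := @Zadjoin_genP C theta.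
have ft := Zadjoin_root htheta.
have X_unit (A : X_set n f) : \val A \in unitmx.
  have /orP[/eqP|/eqP] := valP A.
    exact: cs_root_unitmx hf _.
  exact: cs_star_root_unitmx hf _.
(* If the given representative is a root of the reciprocal polynomial, then its
   inverse is a root of f in the same class. *)
have X_rep (c : X_star n f) :
    exists2 A : X_set n f, star_class A = c & horner_mx (\val A) f = 0.
  elim/quotW: c => A; have uA := X_unit A.
  have /orP[/eqP fA|] := valP A; first by exists A.
  rewrite (cs_star_rootE hf uA) => fAV.
  have X_AV : in_X f (invmx (\val A)) by rewrite /in_X fAV.
  exists (Sub (invmx (\val A)) X_AV : X_set n f).
    apply/star_classP; rewrite SubK; exists 1%:M; rewrite ?unitmx1 //.
    by right; rewrite invmx1 mul1mx mulmx1.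
  by rewrite SubK; apply/eqP.
have X_eigen (A : X_set n f) : horner_mx (\val A) f = 0 ->
    exists2 v : 'cV[R]_n.+1, v != 0 & map_mx intr (\val A) *m v = t *: v.
  exact: (eigenvector_exists t_inj f_monic f_irr f_size ft).
have X_ideal (A : X_set n f) (v : 'cV[R]_n.+1) :
    horner_mx (\val A) f = 0 -> v != 0 ->
    map_mx intr (\val A) *m v = t *: v -> is_nonzero_ideal (Zspan v).
  by move=> _; apply: Zspan_nonzero_ideal.
have S_basis (S : nonzero_ideal R) : exists v : 'cV[R]_n.+1, is_Zbasis S v.
  exact: (ideal_Zbasis t_inj t_gen f_monic f_irr f_size ft (nonzero_idealP S)).
have S_mat (S : nonzero_ideal R) (v : 'cV[R]_n.+1) : is_Zbasis S v ->
    exists! A : 'M[int]_n.+1, t *: v = map_mx intr A *m v.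
  move=> Sv; have [A Av] := Zbasis_matrix t Sv; exists A; split=> // B Bv.
  have [_ free_v] := (is_ZbasisE _ _).1 Sv.
  by apply: (Zfree_mx_inj free_v); rewrite -Av.
have S_root (S : nonzero_ideal R) (v : 'cV[R]_n.+1) (A : 'M[int]_n.+1) :
    is_Zbasis S v -> t *: v = map_mx intr A *m v -> horner_mx A f = 0.
  move=> /is_ZbasisE[_ free_v] Av.
  exact: (eigen_horner_mx_eq0 ft free_v (esym Av)).
have S_X (S : nonzero_ideal R) (v : 'cV[R]_n.+1) (A : 'M[int]_n.+1) :
    is_Zbasis S v -> t *: v = map_mx intr A *m v -> in_X f A.
  by move=> Sv Av; rewrite /in_X (S_root S v A Sv Av) eqxx.
do 7!split=> //.
(* Each class gets a value that agrees with every choice of representative and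
   eigenvector: the representatives are conjugate by some P, P w is an
   eigenvector with the same span as w, and eigenvectors are proportional. *)
have /choice[phi phiP] (c : X_star n f) : exists k : ideal_class_monoid R,
    forall (A : X_set n f) (v : 'cV[R]_n.+1) (S : nonzero_ideal R),
    horner_mx (\val A) f = 0 -> v != 0 ->
    map_mx intr (\val A) *m v = t *: v -> ideal_set S = Zspan v ->
    star_class A = c -> k = ideal_class S.
  have [B <- fB] := X_rep c; have [w w0 Bw] := X_eigen B fB.
  exists (ideal_class (NonzeroIdeal (X_ideal B w fB w0 Bw))).
  move=> A v S fA v0 Av SE /star_classP/(star_equiv_conj hf fA fB)[P uP AP].
  pose u : 'cV[R]_n.+1 := map_mx intr P *m w.
  have Au : map_mx intr (\val A) *m u = t *: u.
    by rewrite /u mulmxA -map_mxM AP mulmxKV // map_mxM -mulmxA Bw scalemxAr.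
  have uw : Zspan u = Zspan w := Zspan_unitmx w uP.
  have u0 : u != 0.
    apply: contra_neq w0 => u0; rewrite -[w]mul1mx -(map_mx1 intr) -(mulVmx uP).
    by rewrite map_mxM -mulmxA -/u u0 mulmx0.
  have [a [b [a0 b0 ab]]] := eigen_proportional t_inj f_irr f_size ft u0 Au v0 Av.
  by apply: (Zspan_classP (v := u) _ SE a0 b0); rewrite /= ?uw ?ab.
(* If a S = b J, then a v and b w are two bases of this ideal. *)
have /choice[psi psiP] (k : ideal_class_monoid R) : exists c : X_star n f,
    forall (S : nonzero_ideal R) (v : 'cV[R]_n.+1) (A : X_set n f),
    is_Zbasis S v -> t *: v = map_mx intr (\val A) *m v ->
    ideal_class S = k -> c = star_class A.
  elim/quotW: k => J; have [w Jw] := S_basis J.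
  have [B [Bw _]] := S_mat J w Jw.
  exists (star_class (Sub B (S_X J w B Jw Bw))) => S v A Sv Av.
  move=> /ideal_classP[a [b [a0 b0 SJ]]]; apply/star_classP.
  have [SE free_v] := (is_ZbasisE _ _).1 Sv.
  have [JE free_w] := (is_ZbasisE _ _).1 Jw.
  have wv : Zspan (b *: w) = Zspan (a *: v).
    by rewrite !Zspan_scale -SE -JE.
  have [P uP DP] := Zspan_eq_unitmx (Zfree_scale b0 free_w) wv.
  rewrite SubK; exists P => //; left.
  apply: (Zfree_eigen_conj (t := t) uP (Zfree_scale a0 free_v) DP).
    by rewrite -scalemxAr -Bw !scalerA mulrC.
  by rewrite -scalemxAr -Av !scalerA mulrC.
have phi_psi : cancel phi psi.
  move=> c; have [A Ac fA] := X_rep c; have [v v0 Av] := X_eigen A fA.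
  pose S := NonzeroIdeal (X_ideal A v fA v0 Av).
  rewrite (phiP c A v S fA v0 Av erefl Ac) -Ac.
  apply: (psiP _ S v) => //; apply/is_ZbasisE; split=> //.
  exact: (eigen_Zfree t_inj f_irr f_size ft v0 Av).
have psi_phi : cancel psi phi.
  move=> k; elim/quotW: k => J; have [w Jw] := S_basis J.
  have [B [Bw _]] := S_mat J w Jw.
  have [JE free_w] := (is_ZbasisE _ _).1 Jw.
  rewrite (psiP _ J w (Sub B (S_X J w B Jw Bw)) Jw _ erefl) ?SubK //.
  apply: (phiP _ (Sub B (S_X J w B Jw Bw)) w J) => //; rewrite ?SubK //.
  - exact: S_root Jw Bw.
  - exact: Zfree_neq0 free_w.
exists phi, psi; split; [|split; [|split; [|split]]] => //.
- by move=> A v S fA v0 Av SE; apply: (phiP _ A v).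
- by move=> S v A Sv Av; apply: (psiP _ S v).
- by exists psi.
- by exists phi.
Qed.
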